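(* There is a sequence of temperature-1 tile assembly systems $\mathcal{T}_n=(T_n,\sigma_n,1)$, each with a single-tile seed $\sigma_n$ and $|T_n|=n$, and a function $h(n)=2n+o(n)$, such that for every $n$ every terminal assembly $a\in\mathcal{A}_\Box[\mathcal{T}_n]$ is finite and of height $h(n)$.
   Context: Abstract Tile Assembly Model at temperature 1 on $\mathbb{Z}^2$: a tile type is a unit square with a glue label on each of its four sides (north, east, south, west); all glues have strength 1 except a special null glue of strength 0. An assembly is a partial function $\alpha:\mathbb{Z}^2\dashrightarrow T$. Two tiles at adjacent positions interact if the glue labels on their abutting sides are equal and of positive strength. A tile assembly system is $\mathcal{T}=(T,\sigma,1)$ with $T$ a finite set of tile types and $\sigma$ the seed assembly, here consisting of exactly one tile. An assembly $\beta$ is obtained from $\alpha$ in one step if $\beta$ extends $\alpha$ by exactly one tile that interacts with at least one tile of $\alpha$ (mismatching glues on other sides are allowed). The producible assemblies are those obtainable from $\sigma$ by finitely many steps; an assembly is terminal if it is producible and no tile can be added to it; $\mathcal{A}_\Box[\mathcal{T}]$ is the set of terminal assemblies (which may be infinite). The height of a finite assembly is $\max y-\min y+1$ over the positions $(x,y)$ of its domain. *)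

(* Defs.v *)
From Stdlib Require Import ZArith List Arith Bool.
Import ListNotations.
Open Scope Z_scope.

(* Glue labels are natural numbers; the label 0 is the null glue (strength 0),
   every other label has strength 1. *)
Record tile : Type := mkTile { gN : nat; gE : nat; gS : nat; gW : nat }.

Definition pos : Type := (Z * Z)%type.

Definition assembly : Type := pos -> option tile.

Record tas : Type := mkTAS { tiles : list tile; seed_pos : pos; seed_tile : tile }.

Definition seed (T : tas) : assembly :=
  fun q => if (fst q =? fst (seed_pos T)) && (snd q =? snd (seed_pos T))
           then Some (seed_tile T) else None.

Definition binds_NS (t u : tile) : Prop := gN t = gS u /\ gN t <> 0%nat.
Definition binds_EW (t u : tile) : Prop := gE t = gW u /\ gE t <> 0%nat.

Definition attachable (a : assembly) (p : pos) (t : tile) : Prop :=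
  let (x, y) := p in
  a (x, y) = None /\
  ( (exists u, a (x, y + 1) = Some u /\ binds_NS t u)
  \/ (exists u, a (x, y - 1) = Some u /\ binds_NS u t)
  \/ (exists u, a (x + 1, y) = Some u /\ binds_EW t u)
  \/ (exists u, a (x - 1, y) = Some u /\ binds_EW u t)).

Definition one_step (T : tas) (a b : assembly) : Prop :=
  exists p t, In t (tiles T) /\ attachable a p t /\
    forall q, b q = (if (fst q =? fst p) && (snd q =? snd p) then Some t else a q).

Inductive fin_producible (T : tas) : assembly -> Prop :=
| fp_seed : forall a, (forall q, a q = seed T q) -> fin_producible T a
| fp_step : forall a b, fin_producible T a -> one_step T a b -> fin_producible T b.

(* results of (possibly infinite) assembly sequences: limits of increasing
   chains of finitely producible assemblies (constant chains give the
   finitely producible ones) *)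
Definition producible (T : tas) (a : assembly) : Prop :=
  exists f : nat -> assembly,
    (forall i, fin_producible T (f i)) /\
    (forall i q t, f i q = Some t -> f (S i) q = Some t) /\
    (forall q t, a q = Some t <-> exists i, f i q = Some t).

Definition terminal (T : tas) (a : assembly) : Prop :=
  producible T a /\ forall p t, In t (tiles T) -> ~ attachable a p t.

Definition finite_assembly (a : assembly) : Prop :=
  exists l : list pos, forall q, a q <> None -> In q l.

Definition has_height (a : assembly) (k : nat) : Prop :=
  exists qmin qmax : pos,
    a qmin <> None /\ a qmax <> None /\
    (forall q, a q <> None -> snd qmin <= snd q <= snd qmax) /\
    snd qmax - snd qmin + 1 = Z.of_nat k.

Definition well_formed_with_size (T : tas) (n : nat) : Prop :=
  NoDup (tiles T) /\ length (tiles T) = n /\ In (seed_tile T) (tiles T).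

Definition two_n_plus_little_o (h : nat -> nat) : Prop :=
  forall k : nat, (0 < k)%nat -> exists N : nat, forall n : nat, (N <= n)%nat ->
    Z.of_nat k * Z.abs (Z.of_nat (h n) - 2 * Z.of_nat n) <= Z.of_nat n.

(* Main.v *)
Require Import Defs.
From Stdlib Require Import ZArith List Arith Lia Bool FinFun.
Import ListNotations.

(* All but O(sqrt n) of the tile types form one column of height h, and the assembly
   contains that column at two heights, one on top of the other.

   From the seed a short feed path leads to the foot of the column.  At the top of the
   column a turn of three tiles leads to a second copy of the column, two cells to the left
   or two cells to the right, which grows downwards: this costs no new types.  The foot of
   the column carries an exit on either side.  At the foot of the first copy both exits
   run aground on the feed path; at the foot of the returning copy the outer exit is free.
   It goes far out to the left and starts a staircase, a loop of O(sqrt n) tile types that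
   climbs to the right and can be repeated until it hits the wall formed by the two copies.
   From each step a hook leads to a new copy of the column.  The hook passes below both
   possible returning copies and blocks all their exits, so nothing is repeated a second
   time.  The highest step is close to the top of the wall, hence the total height is
   about 2h, and the wall is complete before the staircase starts, whatever the order of
   growth.

   To control all orders of growth, every tile is shown to be a node of an explicit tree in
   which it is preceded by all its ancestors; a position at which the tree branches wrongly
   is always occupied by an ancestor. *)

(** * Directions, tile kinds and attachment *)

Inductive dir : Type := dN | dE | dS | dW.
Inductive side : Type := L | R.

Definition opp (d : dir) : dir :=
  match d with dN => dS | dE => dW | dS => dN | dW => dE end.

Definition dir_eqb (d e : dir) : bool :=
  match d, e with
  | dN, dN | dE, dE | dS, dS | dW, dW => true
  | _, _ => false
  end.

(* KM: the column, KT: the turn, KP: the feed path of the first column (KP 0 is the seed),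
   KK: the hook that feeds the later columns, KX: the exits, KS: one step of the staircase. *)
Inductive kind : Type :=
| KM (j : nat) | KT (j : nat) | KP (j : nat) | KK (j : nat)
| KX (s : side) (j : nat) | KS (j : nat).

Local Open Scope Z_scope.

Definition move (p : Z * Z) (d : dir) : Z * Z :=
  match d with
  | dN => (fst p, snd p + 1) | dS => (fst p, snd p - 1)
  | dE => (fst p + 1, snd p) | dW => (fst p - 1, snd p)
  end.

Definition tile_glue (d : dir) (t : tile) : nat :=
  match d with dN => gN t | dE => gE t | dS => gS t | dW => gW t end.

(** Replaces the four cases of attachment by one neighbour [q], a direction [d] from [q] to [p], and
    opposite sides with equal glues. *)
Lemma attachable_spec a p t :
  attachable a p t <-> a p = None /\
  exists q d u, a q = Some u /\ p = move q d /\
    tile_glue d u = tile_glue (opp d) t /\ tile_glue d u <> 0%nat.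
Proof.
  destruct p as [x y]. unfold attachable, binds_NS, binds_EW. split.
  - intros [N H]. split; [easy|].
    destruct H as [(u & A & B & C)|[(u & A & B & C)|[(u & A & B & C)|(u & A & B & C)]]].
    + exists (x, y + 1), dS, u. cbn. rewrite <- B. repeat split; auto. f_equal; lia.
    + exists (x, y - 1), dN, u. cbn. repeat split; auto. f_equal; lia.
    + exists (x + 1, y), dW, u. cbn. rewrite <- B. repeat split; auto. f_equal; lia.
    + exists (x - 1, y), dE, u. cbn. repeat split; auto. f_equal; lia.
  - intros [N ([x' y'] & d & u & A & E & B & C)]. split; [easy|].
    destruct d; cbn in E, B, C; injection E as -> ->.
    + right; left. exists u. replace (y' + 1 - 1) with y' by lia. auto.
    + right; right; right. exists u. replace (x' + 1 - 1) with x' by lia. auto.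
    + left. exists u. replace (y' - 1 + 1) with y' by lia. rewrite <- B. auto.
    + right; right; left. exists u. replace (x' - 1 + 1) with x' by lia. rewrite <- B. auto.
Qed.

Lemma box_finite a (x0 x1 y0 y1 : Z) :
  (forall q, a q <> None -> x0 <= fst q <= x1 /\ y0 <= snd q <= y1) -> finite_assembly a.
Proof.
  intros B.
  exists (list_prod (map (fun n => x0 + Z.of_nat n) (seq 0 (Z.to_nat (x1 - x0 + 1))))
                    (map (fun n => y0 + Z.of_nat n) (seq 0 (Z.to_nat (y1 - y0 + 1))))).
  intros [x y] H. apply B in H. cbn [fst snd] in H. apply in_prod; apply in_map_iff.
  - exists (Z.to_nat (x - x0)). split; [lia|apply in_seq; lia].
  - exists (Z.to_nat (y - y0)). split; [lia|apply in_seq; lia].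
Qed.

(** * Tile types *)

Section Construction.

Local Open Scope nat_scope.

(* c: number of steps of the staircase, v: height of a step. *)
Variables h c v : nat.
Hypothesis c_ge2 : 2 <= c.
(** Keeps the lowest row of the first hook, row [v - 4], at or above the foot of the wall. *)
Hypothesis v_ge4 : 4 <= v.
(** The last step turns east in row [c * v - 3]; the wall must reach that row, and its topmost
    column tile is in row [h - 1]. *)
Hypothesis wall_high : c * v <= h + 2.

(** Interleaves the glue families [f < 8] injectively; the summand 1 avoids the null glue. *)
Definition label (f j : nat) : nat := 8 * j + f + 1.

Definition side_dir (s : side) : dir := match s with L => dW | R => dE end.
Definition exit_label (s : side) : nat := match s with L => 4 | R => 5 end.
(** Both exits must end just below the first stair tile. They start 6 cells apart and their
    staircases 2 cells apart, hence the difference of 4. *)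
Definition exit_length (s : side) : nat :=
  match s with L => 8 * (c - 1) + 4 | R => 8 * (c - 1) + 8 end.

(* In a chain of types, [dir j] is the direction of the move from tile [j - 1] to tile [j]
   and [label f j] the glue between them. *)
Definition seed_dir (j : nat) : dir :=
  match j with
  | 1 | 3 | 4 | 5 => dW | 2 => dS | 7 | 8 => dE | _ => dN
  end.
Definition hook_dir (j : nat) : dir :=
  match j with
  | 3 => dS | 8 | 12 => dN | 9 | 10 | 11 => dE | _ => dW
  end.
Definition exit_dir (s : side) (j : nat) : dir :=
  if j =? 0 then side_dir s else if j <? 4 then dS
  else if j <? exit_length s then dW else dN.
Definition stair_dir (j : nat) : dir :=
  if j <? v then dN else if j <? v + 8 then dE else dN.

(** [din] is the direction of travel into the tile, so the entry glue lies on the opposite side. *)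
Definition chain (din : dir) (lin : nat) (dout : dir) (lout : nat) (d : dir) : nat :=
  if dir_eqb d (opp din) then lin else if dir_eqb d dout then lout else 0.

(** [KT 0] and [KT 2] both carry [label 0 h] on their south side, so the turn can be entered from
    either end. Both the exits and a completed step end in [label 6 0], which closes the loop of the
    staircase. [KS (v - 1)] has a third glue, on the west, for the hook. *)
Definition glue (d : dir) (t : kind) : nat :=
  match t with
  | KM j => match d with
            | dN => label 0 (j + 1) | dS => label 0 j
            | dW => if j =? 0 then label 4 0 else 0
            | dE => if j =? 0 then label 5 0 else 0
            end
  | KT j => match j, d with
            | 0, dS => label 0 h | 0, dW => label 1 1
            | 1, dE => label 1 1 | 1, dW => label 1 2
            | 2, dE => label 1 2 | 2, dS => label 0 h
            | _, _ => 0
            end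
  | KP j => chain (seed_dir j) (if j =? 0 then 0 else label 2 j)
                  (seed_dir (j + 1)) (if j =? 8 then label 0 0 else label 2 (j + 1)) d
  | KK j => chain (hook_dir j) (label 3 j)
                  (hook_dir (j + 1)) (if j =? 11 then label 0 0 else label 3 (j + 1)) d
  | KX s j => chain (exit_dir s j) (label (exit_label s) j) (exit_dir s (j + 1))
                    (if j + 1 =? exit_length s then label 6 0
                     else label (exit_label s) (j + 1)) d
  | KS j => if (j =? v - 1) && dir_eqb d dW then label 3 0
            else chain (stair_dir j) (label 6 j) (stair_dir (j + 1))
                       (if j + 1 =? v + 8 then label 6 0 else label 6 (j + 1)) d
  end.

Definition valid (t : kind) : Prop :=
  match t with
  | KM j => j < h | KT j => j < 3 | KP j => j < 9 | KK j => j < 12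
  | KX s j => j < exit_length s | KS j => j < v + 8
  end.

Definition kind_tile (t : kind) : tile :=
  mkTile (glue dN t) (glue dE t) (glue dS t) (glue dW t).

(** * Bonds: which sides of which kinds can stick together *)

Definition out_dir (f j : nat) : dir :=
  match f with
  | 0 => dN | 1 => dW | 2 => seed_dir j | 3 => hook_dir j
  | 4 => exit_dir L j | 5 => exit_dir R j | _ => stair_dir j
  end.

(* [out_port t f j]: t is the first and [in_port t f j] the second end of the bond labelled
   [label f j], the first being the one nearer to the seed in the order of the chain; the
   returning columns are traversed against this order. *)
Inductive out_port : kind -> nat -> nat -> Prop :=
| out_M j j' : j' = j + 1 -> out_port (KM j) 0 j'
| out_M_X s f : f = exit_label s -> out_port (KM 0) f 0
| out_T j j' : j < 2 -> j' = j + 1 -> out_port (KT j) 1 j'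
| out_P j j' : j < 8 -> j' = j + 1 -> out_port (KP j) 2 j'
| out_P_M : out_port (KP 8) 0 0
| out_K j j' : j < 11 -> j' = j + 1 -> out_port (KK j) 3 j'
| out_K_M : out_port (KK 11) 0 0
| out_X s j f j' : j' = j + 1 -> j' < exit_length s -> f = exit_label s ->
    out_port (KX s j) f j'
| out_X_S s j : j + 1 = exit_length s -> out_port (KX s j) 6 0
| out_S j j' : j' = j + 1 -> j' < v + 8 -> out_port (KS j) 6 j'
| out_S_S j : j + 1 = v + 8 -> out_port (KS j) 6 0
| out_S_K j : j + 1 = v -> out_port (KS j) 3 0.

Inductive in_port : kind -> nat -> nat -> Prop :=
| in_M j : in_port (KM j) 0 j
| in_T_M j j' : j = 0 \/ j = 2 -> j' = h -> in_port (KT j) 0 j'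
| in_T j : 0 < j -> in_port (KT j) 1 j
| in_P j : 0 < j -> in_port (KP j) 2 j
| in_K j : in_port (KK j) 3 j
| in_X s j f : f = exit_label s -> in_port (KX s j) f j
| in_S j : in_port (KS j) 6 j.

Lemma label_inj f j f' j' :
  f < 8 -> f' < 8 -> label f j = label f' j' -> f = f' /\ j = j'.
Proof. unfold label; lia. Qed.

Lemma opp_neq d : opp d <> d.
Proof. destruct d; discriminate. Qed.

Lemma opp_opp d : opp (opp d) = d.
Proof. destruct d; reflexivity. Qed.

Lemma dir_eqb_eq d e : dir_eqb d e = true <-> d = e.
Proof. destruct d, e; split; intro; try discriminate; reflexivity. Qed.

Lemma chain_inv din lin dout lout d :
  chain din lin dout lout d <> 0 ->
  (d = opp din /\ chain din lin dout lout d = lin) \/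
  (d = dout /\ chain din lin dout lout d = lout).
Proof.
  unfold chain. destruct (dir_eqb d (opp din)) eqn:E; [apply dir_eqb_eq in E; auto|].
  destruct (dir_eqb d dout) eqn:E'; [apply dir_eqb_eq in E'; auto|congruence].
Qed.

Lemma chain_in din lin dout lout : chain din lin dout lout (opp din) = lin.
Proof. unfold chain. now replace (dir_eqb _ _) with true by now destruct din. Qed.

Lemma chain_out din lin dout lout :
  dout <> opp din -> chain din lin dout lout dout = lout.
Proof.
  unfold chain. intros H. destruct (dir_eqb dout (opp din)) eqn:E.
  - apply dir_eqb_eq in E. congruence.
  - now replace (dir_eqb _ _) with true by now destruct dout.
Qed.

Lemma port_family_out t f j : out_port t f j -> f < 8.
Proof. destruct 1; try lia; subst; destruct s; cbn; lia. Qed.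

Lemma port_family_in t f j : in_port t f j -> f < 8.
Proof. destruct 1; try lia; subst; destruct s; cbn; lia. Qed.

(** Every non-null glue is one of the two ends of a bond, and the side that carries it tells which
    end it is. *)
Lemma glue_port t d :
  valid t -> glue d t <> 0 ->
  exists f j, glue d t = label f j /\
    ((out_port t f j /\ d = out_dir f j) \/ (in_port t f j /\ d = opp (out_dir f j))).
Proof.
  destruct t as [j|j|j|j|s j|j]; cbn [valid]; intros V H.
  - destruct d; cbn [glue] in *.
    + exists 0, (j + 1). split; [easy|]. left; split; [now constructor|easy].
    + destruct (Nat.eqb_spec j 0); [subst|easy].
      exists 5, 0. split; [easy|]. left; split; [now apply out_M_X with R|easy].
    + exists 0, j. split; [easy|]. right; split; [now constructor|easy].
    + destruct (Nat.eqb_spec j 0); [subst|easy].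
      exists 4, 0. split; [easy|]. left; split; [now apply out_M_X with L|easy].
  - destruct j as [|[|[|j]]]; [| | |lia]; destruct d; cbn [glue] in *; try easy.
    + exists 0, h. split; [easy|]. right; split; [constructor; auto|easy].
    + exists 1, 1. split; [easy|]. left; split; [constructor; lia|easy].
    + exists 1, 1. split; [easy|]. right; split; [constructor; lia|easy].
    + exists 1, 2. split; [easy|]. left; split; [constructor; lia|easy].
    + exists 1, 2. split; [easy|]. right; split; [constructor; lia|easy].
    + exists 0, h. split; [easy|]. right; split; [constructor; auto|easy].
  - cbn [glue] in *. destruct (chain_inv _ _ _ _ _ H) as [[Hd E]|[Hd E]].
    + rewrite E in *. destruct (Nat.eqb_spec j 0); [easy|].
      exists 2, j. split; [easy|]. right; split; [constructor; lia|easy].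
    + rewrite E in *. destruct (Nat.eqb_spec j 8).
      * subst j. exists 0, 0. split; [easy|]. left; split; [constructor|easy].
      * exists 2, (j + 1). split; [easy|]. left; split; [constructor; lia|easy].
  - cbn [glue] in *. destruct (chain_inv _ _ _ _ _ H) as [[Hd E]|[Hd E]].
    + rewrite E in *.
      exists 3, j. split; [easy|]. right; split; [constructor; lia|easy].
    + rewrite E in *. destruct (Nat.eqb_spec j 11).
      * subst j. exists 0, 0. split; [easy|]. left; split; [constructor|easy].
      * exists 3, (j + 1). split; [easy|]. left; split; [constructor; lia|easy].
  - cbn [glue] in *. destruct (chain_inv _ _ _ _ _ H) as [[Hd E]|[Hd E]].
    + rewrite E in *.
      exists (exit_label s), j. split; [easy|]. right; split; [now constructor|].
      now destruct s.
    + rewrite E in *. destruct (Nat.eqb_spec (j + 1) (exit_length s)).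
      * exists 6, 0. split; [easy|]. left; split; [now apply out_X_S with (s := s)|].
        subst d. unfold exit_dir, out_dir, stair_dir.
        destruct (Nat.eqb_spec (j + 1) 0); [lia|].
        destruct (Nat.ltb_spec (j + 1) 4); [destruct s; cbn in *; lia|].
        destruct (Nat.ltb_spec (j + 1) (exit_length s)); [lia|].
        destruct (Nat.ltb_spec 0 v); [easy|lia].
      * exists (exit_label s), (j + 1). split; [easy|].
        left; split; [constructor; [easy|lia|easy]|now destruct s].
  - cbn [glue] in *. destruct ((j =? v - 1) && dir_eqb d dW) eqn:E.
    + apply andb_prop in E as [E1 E2]. apply Nat.eqb_eq in E1. apply dir_eqb_eq in E2.
      exists 3, 0. split; [easy|]. left; split; [apply out_S_K; lia|easy].
    + destruct (chain_inv _ _ _ _ _ H) as [[Hd E']|[Hd E']]; rewrite E' in *.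
      * exists 6, j. split; [easy|]. right; split; [now constructor|easy].
      * destruct (Nat.eqb_spec (j + 1) (v + 8)).
        -- exists 6, 0. split; [easy|]. left; split; [now apply out_S_S|].
           subst d. cbn. unfold stair_dir.
           destruct (Nat.ltb_spec (j + 1) v); [lia|].
           destruct (Nat.ltb_spec (j + 1) (v + 8)); [lia|].
           destruct (Nat.ltb_spec 0 v); [easy|lia].
        -- exists 6, (j + 1). split; [easy|]. left; split; [constructor; lia|easy].
Qed.

Ltac split_ltb :=
  repeat match goal with
  | |- context [?a =? ?b] => destruct (Nat.eqb_spec a b)
  | |- context [?a <? ?b] => destruct (Nat.ltb_spec a b)
  end.

(** A path that never reverses leaves a tile by another side than it entered, as [chain_out]
    requires. *)
Lemma exit_dir_turn s j : j + 1 < exit_length s + 1 -> exit_dir s (j + 1) <> opp (exit_dir s j).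
Proof.
  unfold exit_dir. intros H. assert (8 <= exit_length s) by (destruct s; cbn; lia).
  split_ltb; destruct s; cbn in *; try discriminate; lia.
Qed.

Lemma stair_dir_turn j : stair_dir (j + 1) <> opp (stair_dir j).
Proof. unfold stair_dir. split_ltb; cbn; try discriminate; lia. Qed.

Lemma out_port_glue t f j :
  valid t -> out_port t f j -> glue (out_dir f j) t = label f j.
Proof.
  destruct 2; cbn [valid] in *; subst; try reflexivity.
  - now destruct s.
  - destruct j as [|[|j]]; [easy|easy|lia].
  - do 8 (destruct j as [|j]; [reflexivity|]); lia.
  - do 11 (destruct j as [|j]; [reflexivity|]); lia.
  - replace (out_dir (exit_label s) (j + 1)) with (exit_dir s (j + 1)) by now destruct s.
    cbn [glue]. rewrite chain_out by (apply exit_dir_turn; lia).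
    destruct (Nat.eqb_spec (j + 1) (exit_length s)); [lia|easy].
  - replace (out_dir 6 0) with (exit_dir s (j + 1)).
    + cbn [glue]. rewrite chain_out by (apply exit_dir_turn; lia).
      destruct (Nat.eqb_spec (j + 1) (exit_length s)); [easy|lia].
    + assert (8 <= exit_length s) by (destruct s; cbn; lia).
      cbn. unfold exit_dir, stair_dir. split_ltb; try easy; lia.
  - cbn [glue out_dir]. destruct (Nat.eqb_spec j (v - 1)); cbn [andb].
    + replace (stair_dir (j + 1)) with dE by (unfold stair_dir; split_ltb; try easy; lia).
      cbn. replace (stair_dir j) with dN by (unfold stair_dir; split_ltb; try easy; lia).
      unfold chain; cbn. destruct (Nat.eqb_spec (j + 1) (v + 8)); [lia|easy].
    + rewrite chain_out by apply stair_dir_turn.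
      destruct (Nat.eqb_spec (j + 1) (v + 8)); [lia|easy].
  - cbn [glue]. destruct (Nat.eqb_spec j (v - 1)); [lia|]; cbn [andb].
    replace (out_dir 6 0) with (stair_dir (j + 1)).
    + rewrite chain_out by apply stair_dir_turn.
      destruct (Nat.eqb_spec (j + 1) (v + 8)); [easy|lia].
    + cbn. unfold stair_dir. split_ltb; try easy; lia.
  - cbn [glue]. destruct (Nat.eqb_spec j (v - 1)); [easy|lia].
Qed.

Lemma in_port_glue t f j :
  valid t -> in_port t f j -> glue (opp (out_dir f j)) t = label f j.
Proof.
  destruct 2; cbn [valid] in *; subst; try reflexivity.
  - destruct H0; subst; easy.
  - destruct j as [|[|[|j]]]; [lia|easy|easy|lia].
  - cbn [glue out_dir]. rewrite chain_in. destruct (Nat.eqb_spec j 0); [lia|easy].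
  - cbn [glue out_dir]. now rewrite chain_in.
  - replace (out_dir (exit_label s) j) with (exit_dir s j) by now destruct s.
    cbn [glue]. now rewrite chain_in.
  - cbn [glue out_dir]. replace (dir_eqb _ dW) with (dir_eqb (stair_dir j) dE) by now destruct (stair_dir j).
    destruct (Nat.eqb_spec j (v - 1)); cbn [andb].
    + replace (stair_dir j) with dN by (unfold stair_dir; split_ltb; try easy; lia).
      easy.
    + now rewrite chain_in.
Qed.

(** The label determines the bond and the side determines its end, since [opp d] differs from
    [d]. *)
Lemma glue_out_port t f j :
  valid t -> f < 8 -> glue (out_dir f j) t = label f j -> out_port t f j.
Proof.
  intros V Hf E. destruct (glue_port t (out_dir f j)) as (f' & j' & E' & H); [easy| |].
  - rewrite E. unfold label; lia.
  - assert (f' < 8) by (destruct H as [[H _]|[H _]];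
      [exact (port_family_out _ _ _ H)|exact (port_family_in _ _ _ H)]).
    destruct (label_inj f j f' j') as [-> ->]; [easy|easy|congruence|].
    destruct H as [[H _]|[_ H]]; [easy|]. now destruct (opp_neq (out_dir f' j')).
Qed.

Lemma glue_in_port t f j :
  valid t -> f < 8 -> glue (opp (out_dir f j)) t = label f j -> in_port t f j.
Proof.
  intros V Hf E. destruct (glue_port t (opp (out_dir f j))) as (f' & j' & E' & H); [easy| |].
  - rewrite E. unfold label; lia.
  - assert (f' < 8) by (destruct H as [[H _]|[H _]];
      [exact (port_family_out _ _ _ H)|exact (port_family_in _ _ _ H)]).
    destruct (label_inj f j f' j') as [-> ->]; [easy|easy|congruence|].
    destruct H as [[_ H]|[H _]]; [now destruct (opp_neq (out_dir f' j'))|easy].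
Qed.

(** Reduces every possible interaction to the two ends of one bond; the cases give the end already
    present. *)
Lemma glue_match t u d :
  valid t -> valid u -> glue d t = glue (opp d) u -> glue d t <> 0 ->
  exists f j, (out_port t f j /\ in_port u f j /\ d = out_dir f j) \/
              (in_port t f j /\ out_port u f j /\ d = opp (out_dir f j)).
Proof.
  intros Vt Vu E N. destruct (glue_port t d Vt N) as (f & j & El & [[H ->]|[H ->]]);
    exists f, j; [left|right]; repeat split; try easy.
  - apply glue_in_port; [easy|exact (port_family_out _ _ _ H)|congruence].
  - rewrite opp_opp in E. apply glue_out_port; [easy|exact (port_family_in _ _ _ H)|congruence].
Qed.

Lemma kind_tile_glue t u : kind_tile t = kind_tile u -> forall d, glue d t = glue d u.
Proof. intros E. injection E. intros. now destruct d. Qed.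

(** Equal tiles have the same ports. The in-port identifies the kind, except for [KT 0], whose
    in-port is shared with [KT 2], and the seed [KP 0], which has none; these two are recognized by
    their out-port. *)
Lemma kind_tile_inj t u : valid t -> valid u -> kind_tile t = kind_tile u -> t = u.
Proof.
  intros Vt Vu E. pose proof (kind_tile_glue _ _ E) as G.
  assert (I : forall f j, in_port t f j -> in_port u f j).
  { intros f j H. apply glue_in_port; [easy|exact (port_family_in _ _ _ H)|].
    rewrite <- G. now apply in_port_glue. }
  assert (O : forall f j, out_port t f j -> out_port u f j).
  { intros f j H. apply glue_out_port; [easy|exact (port_family_out _ _ _ H)|].
    rewrite <- G. now apply out_port_glue. }
  destruct t as [j|j|j|j|s j|j]; cbn [valid] in Vt.
  - pose proof (I _ _ (in_M j)) as H. inversion H; subst; cbn in *; try easy; try lia.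
    now destruct s.
  - destruct (Nat.eq_dec j 0) as [->|].
    + pose proof (O 1 1 (out_T 0 1 ltac:(lia) eq_refl)) as H.
      inversion H; subst; cbn in *; try (f_equal; lia). now destruct s.
    + pose proof (I _ _ (in_T j ltac:(lia))) as H.
      inversion H; subst; cbn in *; try easy. now destruct s.
  - destruct (Nat.eq_dec j 0) as [->|].
    + pose proof (O 2 1 (out_P 0 1 ltac:(lia) eq_refl)) as H.
      inversion H; subst; cbn in *; try (f_equal; lia). now destruct s.
    + pose proof (I _ _ (in_P j ltac:(lia))) as H.
      inversion H; subst; cbn in *; try easy. now destruct s.
  - pose proof (I _ _ (in_K j)) as H. inversion H; subst; cbn in *; try easy.
    now destruct s.
  - pose proof (I _ _ (in_X s j _ eq_refl)) as H.
    inversion H as [| | | | |s' j' f' Hl|]; subst; cbn in *; destruct s; try easy;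
      destruct s'; easy.
  - pose proof (I _ _ (in_S j)) as H. inversion H; subst; cbn in *; try easy.
    now destruct s.
Qed.

(** * The number of tile types *)

Definition kinds : list kind :=
  map KM (seq 0 h) ++ map KT (seq 0 3) ++ map KP (seq 0 9) ++ map KK (seq 0 12) ++
  map (KX L) (seq 0 (exit_length L)) ++ map (KX R) (seq 0 (exit_length R)) ++
  map KS (seq 0 (v + 8)).

Lemma in_kinds t : In t kinds <-> valid t.
Proof.
  unfold kinds. rewrite !in_app_iff, !in_map_iff. split.
  - intros H. repeat destruct H as [H|H]; destruct H as (j & <- & H);
      apply in_seq in H; cbn [valid]; lia.
  - destruct t as [j|j|j|j|[|] j|j]; cbn [valid]; intros H;
      [do 0 right|do 1 right|do 2 right|do 3 right|do 4 right|do 5 right|do 6 right];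
      try left; exists j; (split; [easy|apply in_seq; lia]).
Qed.

Lemma NoDup_kinds : NoDup kinds.
Proof.
  assert (I : forall (f : nat -> kind) n,
    (forall x y, f x = f y -> x = y) -> NoDup (map f (seq 0 n))).
  { intros f n Hf. apply Injective_map_NoDup; [exact Hf|apply seq_NoDup]. }
  assert (D : forall (l : list kind) (f : nat -> kind) n,
    (forall x, ~ In (f x) l) -> (forall x y, f x = f y -> x = y) -> NoDup l ->
    NoDup (map f (seq 0 n) ++ l)).
  { intros l f n Hd Hf Hl. apply NoDup_app; [now apply I|easy|].
    intros t Ht. apply in_map_iff in Ht as (x & <- & _). apply Hd. }
  unfold kinds. repeat apply D; try (now intros x y [= ->]);
    try (intros x H; rewrite ?in_app_iff, ?in_map_iff in H;
         repeat destruct H as [H|H]; destruct H as (y & [=] & _)).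
  now apply I; intros x y [= ->].
Qed.

Lemma length_kinds : length kinds = h + v + 16 * c + 28.
Proof.
  unfold kinds. rewrite !length_app, !length_map, !length_seq.
  cbn [exit_length]. lia.
Qed.

Definition system : tas :=
  mkTAS (map kind_tile kinds) (2, -1)%Z (kind_tile (KP 0)).

Lemma in_tiles t : In t (tiles system) <-> exists k, valid k /\ kind_tile k = t.
Proof.
  cbn. rewrite in_map_iff. split; intros (k & H & H'); exists k;
    rewrite in_kinds in *; auto.
Qed.

Lemma system_well_formed : well_formed_with_size system (h + v + 16 * c + 28).
Proof.
  repeat split.
  - cbn. assert (forall l, (forall t, In t l -> valid t) -> NoDup l -> NoDup (map kind_tile l)).
    { induction l as [|t l IH]; cbn; intros V N; [constructor|].
      inversion_clear N as [|? ? N1 N2]. constructor; [|auto].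
      intros H. apply in_map_iff in H as (u & E & Hu).
      apply kind_tile_inj in E; [subst; auto|auto|auto]. }
    apply H; [apply in_kinds|apply NoDup_kinds].
  - cbn. rewrite length_map. apply length_kinds.
  - apply in_tiles. exists (KP 0). split; [cbn; lia|easy].
Qed.

(** * The tree of nodes *)

(* A column stands at the seed (Root) or at step i of the staircase that starts from the
   exit D, which is the one of the world where the first turn goes to side D. *)
Inductive ctx : Type := Root | Step (D : side) (i : nat).

(* Fd: feed path, Co: column, Tp: turn towards E, Re: returning column on side E,
   Sc and Sr: blocked first tile of an exit at the foot of Co and Re, Ex: the free exit,
   St: tile j of step i of the staircase. *)
Inductive node : Type :=
| Fd (x : ctx) (j : nat)
| Co (x : ctx) (j : nat)
| Tp (x : ctx) (E : side) (j : nat)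
| Re (x : ctx) (E : side) (j : nat)
| Sc (x : ctx) (s : side)
| Sr (x : ctx) (E s : side)
| Ex (D : side) (j : nat)
| St (D : side) (i j : nat).

Definition node_kind (u : node) : kind :=
  match u with
  | Fd Root j => KP j | Fd (Step _ _) j => KK j
  | Co _ j | Re _ _ j => KM j
  | Tp _ L j => KT j | Tp _ R j => KT (2 - j)
  | Sc _ s | Sr _ _ s => KX s 0
  | Ex D j => KX D j
  | St _ _ j => KS j
  end.

(** * Coordinates of the nodes *)

Local Open Scope Z_scope.

Definition sg (s : side) : Z := match s with L => -1 | R => 1 end.

Definition seed_offset (j : nat) : Z * Z :=
  match j with
  | 0%nat => (2, -1) | 1%nat => (1, -1) | 2%nat => (1, -2) | 3%nat => (0, -2) | 4%nat => (-1, -2)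
  | 5%nat => (-2, -2) | 6%nat => (-2, -1) | 7%nat => (-1, -1) | _ => (0, -1)
  end.

Definition hook_offset (j : nat) : Z * Z :=
  match j with
  | 0%nat => (3, -1) | 1%nat => (2, -1) | 2%nat => (1, -1) | 3%nat => (1, -2) | 4%nat => (0, -2)
  | 5%nat => (-1, -2) | 6%nat => (-2, -2) | 7%nat => (-3, -2) | 8%nat => (-3, -1) | 9%nat => (-2, -1)
  | 10%nat => (-1, -1) | _ => (0, -1)
  end.

(** The last step rises in the column [sg D - 2], directly left of the wall. Steps are 8 apart
    because everything a hook feeds fits into a width of 7. *)
Definition step_x (D : side) (i : nat) : Z :=
  sg D - 2 - 8 * (Z.of_nat c - 1 - Z.of_nat i).
Definition step_y (i : nat) : Z := Z.of_nat i * Z.of_nat v - 3.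

(** The foot of the column. The shift puts the first hook tile, at offset (3, -1), directly west of
    stair tile [v - 1]. *)
Definition base (x : ctx) : Z * Z :=
  match x with
  | Root => (0, 0)
  | Step D i => (step_x D i - 4, step_y i + Z.of_nat v + 1)
  end.

Definition feed_length (x : ctx) : nat := match x with Root => 9 | Step _ _ => 12 end.
Definition feed_offset (x : ctx) (j : nat) : Z * Z :=
  match x with Root => seed_offset j | Step _ _ => hook_offset j end.

(** Truncated subtraction and [Nat.min] describe the bent paths: an exit descends up to [j = 3] and
    then runs west, a step rises up to [j = v - 1] and then runs east. *)
Definition node_pos (u : node) : Z * Z :=
  match u with
  | Fd x j => (fst (base x) + fst (feed_offset x j), snd (base x) + snd (feed_offset x j))
  | Co x j => (fst (base x), snd (base x) + Z.of_nat j)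
  | Tp x E j => (fst (base x) + sg E * Z.of_nat j, snd (base x) + Z.of_nat h)
  | Re x E j => (fst (base x) + 2 * sg E, snd (base x) + Z.of_nat j)
  | Sc x s => (fst (base x) + sg s, snd (base x))
  | Sr x E s => (fst (base x) + 2 * sg E + sg s, snd (base x))
  | Ex D j => (3 * sg D - Z.of_nat (j - 3), - Z.of_nat (Nat.min j 3))
  | St D i j => (step_x D i + Z.of_nat (j + 1 - v),
                 step_y i + Z.of_nat (Nat.min (j + 1) v))
  end.

(** Both turns are children of the top of a column, so the tree holds mutually exclusive outcomes.
    The last step keeps only its rising part, and the outer exit at the returning root column is
    [Ex] instead of [Sr]. *)
Inductive child : node -> node -> Prop :=
| ch_Fd x j : (S j < feed_length x)%nat -> child (Fd x j) (Fd x (S j))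
| ch_Fd_Co x j : S j = feed_length x -> child (Fd x j) (Co x 0)
| ch_Co x j : (S j < h)%nat -> child (Co x j) (Co x (S j))
| ch_Co_Tp x E j : S j = h -> child (Co x j) (Tp x E 0)
| ch_Tp x E j : (j < 2)%nat -> child (Tp x E j) (Tp x E (S j))
| ch_Tp_Re x E j : S j = h -> child (Tp x E 2) (Re x E j)
| ch_Re x E j : child (Re x E (S j)) (Re x E j)
| ch_Sc x s : child (Co x 0) (Sc x s)
| ch_Sr x E s : ~ (x = Root /\ s = E) -> child (Re x E 0) (Sr x E s)
| ch_Re_Ex D : child (Re Root D 0) (Ex D 0)
| ch_Ex D j : (S j < exit_length D)%nat -> child (Ex D j) (Ex D (S j))
| ch_Ex_St D j : S j = exit_length D -> child (Ex D j) (St D 0 0)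
| ch_St D i j : (S j < v + 8)%nat -> (S j < v \/ S i < c)%nat ->
    child (St D i j) (St D i (S j))
| ch_St_St D i j : S j = (v + 8)%nat -> (S i < c)%nat -> child (St D i j) (St D (S i) 0)
| ch_St_Fd D i j : S j = v -> child (St D i j) (Fd (Step D i) 0).

(** * Grown nodes and what their ancestors guarantee *)

Definition at_node (a : assembly) (u : node) : Prop :=
  a (node_pos u) = Some (kind_tile (node_kind u)).

(** Demands the whole path from the seed, because distinct nodes may share a cell and the ancestors
    are what blocks wrong growth. *)
Inductive grown (a : assembly) : node -> Prop :=
| grown_seed : at_node a (Fd Root 0) -> grown a (Fd Root 0)
| grown_child u w : grown a u -> child u w -> at_node a w -> grown a w.

Lemma grown_at a u : grown a u -> at_node a u.
Proof. now destruct 1. Qed.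

Definition fed (a : assembly) (x : ctx) : Prop :=
  forall j, (j < feed_length x)%nat -> at_node a (Fd x j).
Definition column (a : assembly) (x : ctx) : Prop :=
  forall j, (j < h)%nat -> at_node a (Co x j).
Definition capped (a : assembly) (x : ctx) (E : side) : Prop :=
  forall j, (j < 3)%nat -> at_node a (Tp x E j).
Definition wall (a : assembly) (D : side) : Prop :=
  fed a Root /\ column a Root /\ capped a Root D /\
  forall j, (j < h)%nat -> at_node a (Re Root D j).
Definition ctx_ok (a : assembly) (x : ctx) : Prop :=
  match x with Root => True | Step D i => wall a D /\ (i < c)%nat end.

(** Keeps the facts about ancestors that are used for blocking: the feed below the feet and exits,
    the part of a column or turn already passed, and, from the free exit on, the finished wall. *)
Definition history (a : assembly) (u : node) : Prop :=
  match u with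
  | Fd x j => ctx_ok a x /\ (j < feed_length x)%nat /\
      (forall j', (j' <= j)%nat -> at_node a (Fd x j'))
  | Co x j => ctx_ok a x /\ (j < h)%nat /\ fed a x /\
      (forall j', (j' <= j)%nat -> at_node a (Co x j'))
  | Tp x E j => ctx_ok a x /\ (j < 3)%nat /\ fed a x /\ column a x /\
      (forall j', (j' <= j)%nat -> at_node a (Tp x E j'))
  | Re x E j => ctx_ok a x /\ (j < h)%nat /\ fed a x /\ column a x /\ capped a x E /\
      (forall j', (j <= j' < h)%nat -> at_node a (Re x E j'))
  | Sc x s => ctx_ok a x /\ fed a x /\ at_node a (Co x 0)
  | Sr x E s => ctx_ok a x /\ fed a x /\ at_node a (Re x E 0) /\ capped a x E /\
      ~ (x = Root /\ s = E)
  | Ex D j => wall a D /\ (j < exit_length D)%nat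
  | St D i j => wall a D /\ (i < c)%nat /\ (j < v + 8)%nat /\ (j < v \/ S i < c)%nat
  end.

Lemma h_ge6 : (6 <= h)%nat.
Proof. nia. Qed.

Lemma exit_length_ge D : (8 <= exit_length D)%nat.
Proof. destruct D; cbn; lia. Qed.

(** Each node extends the record of its parent by itself; when the path passes to the next portion,
    the record of the previous one has become complete. *)
Lemma grown_history a u : grown a u -> history a u.
Proof.
  pose proof h_ge6 as Hh.
  induction 1 as [H|u w G IH C H].
  - cbn; repeat split; try lia. intros j' Hj. now replace j' with 0%nat by lia.
  - assert (Hu := grown_at _ _ G).
    destruct C; cbn [history] in *.
    + destruct IH as (I1 & I2 & I3). repeat split; auto.
      intros j' Hj. destruct (Nat.eq_dec j' (S j)); [now subst|apply I3; lia].
    + destruct IH as (I1 & I2 & I3). repeat split; auto; try lia.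
      * intros j' Hj. apply I3; lia.
      * intros j' Hj. now replace j' with 0%nat by lia.
    + destruct IH as (I1 & I2 & I3 & I4). repeat split; auto.
      intros j' Hj. destruct (Nat.eq_dec j' (S j)); [now subst|apply I4; lia].
    + destruct IH as (I1 & I2 & I3 & I4). repeat split; auto; try lia.
      * intros j' Hj. apply I4; lia.
      * intros j' Hj. now replace j' with 0%nat by lia.
    + destruct IH as (I1 & I2 & I3 & I4 & I5). repeat split; auto; try lia.
      intros j' Hj. destruct (Nat.eq_dec j' (S j)); [now subst|apply I5; lia].
    + destruct IH as (I1 & I2 & I3 & I4 & I5). repeat split; auto; try lia.
      * intros j' Hj. apply I5; lia.
      * intros j' Hj. now replace j' with j by lia.
    + destruct IH as (I1 & I2 & I3 & I4 & I5 & I6). repeat split; auto; try lia.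
      intros j' Hj. destruct (Nat.eq_dec j' j); [now subst|apply I6; lia].
    + destruct IH as (I1 & I2 & I3 & I4). auto.
    + destruct IH as (I1 & I2 & I3 & I4 & I5 & I6). auto.
    + destruct IH as (I1 & I2 & I3 & I4 & I5 & I6). pose proof (exit_length_ge D).
      repeat split; auto; try lia. intros j Hj. apply I6; lia.
    + destruct IH as (I1 & I2). split; auto.
    + destruct IH as (I1 & I2). split; [exact I1|lia].
    + destruct IH as (I1 & I2 & I3 & I4). auto.
    + destruct IH as (I1 & I2 & I3 & I4). split; [exact I1|lia].
    + destruct IH as (I1 & I2 & I3 & I4). cbn. repeat split; auto; try lia; try apply I1.
      intros j' Hj. now replace j' with 0%nat by lia.
Qed.

Definition ctx_in_range (x : ctx) : Prop :=
  match x with Root => True | Step _ i => (i < c)%nat end.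

Definition in_range (u : node) : Prop :=
  match u with
  | Fd x j => (j < feed_length x)%nat /\ ctx_in_range x
  | Co x j | Re x _ j => (j < h)%nat /\ ctx_in_range x
  | Tp x _ j => (j < 3)%nat /\ ctx_in_range x
  | Sc x _ => ctx_in_range x
  | Sr x E s => ~ (x = Root /\ s = E) /\ ctx_in_range x
  | Ex D j => (j < exit_length D)%nat
  | St _ i j => (i < c)%nat /\ (j < v + 8)%nat /\ (j < v \/ S i < c)%nat
  end.

Lemma grown_in_range a u : grown a u -> in_range u.
Proof.
  intros G. apply grown_history in G.
  destruct u as [[|D i] j|[|D i] j|[|D i] E j|[|D i] E j|[|D i] s|[|D i] E s|D j|D i j];
    cbn in *; tauto.
Qed.

Lemma in_range_valid u : in_range u -> valid (node_kind u).
Proof.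
  pose proof h_ge6. destruct u as [[|D i] j|x j|x [|] j|x E j|x s|x E s|D j|D i j];
    cbn [in_range node_kind valid feed_length] in *; try tauto; try lia;
    pose proof (exit_length_ge s); lia.
Qed.

Lemma grown_valid a u : grown a u -> valid (node_kind u).
Proof. intros G. now apply in_range_valid, (grown_in_range a). Qed.

Lemma at_blocks a u q : at_node a u -> node_pos u = q -> a q <> None.
Proof. intros H <-. rewrite H. discriminate. Qed.

Lemma seed_offset_step j : (j < 8)%nat ->
  seed_offset (S j) = move (seed_offset j) (seed_dir (S j)).
Proof. intros H. do 8 (destruct j as [|j]; [reflexivity|]); lia. Qed.

Lemma hook_offset_step j : (j < 11)%nat ->
  hook_offset (S j) = move (hook_offset j) (hook_dir (S j)).
Proof. intros H. do 11 (destruct j as [|j]; [reflexivity|]); lia. Qed.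

Lemma in_port_inv t f j : in_port t f j -> (f < 8)%nat ->
  match f with
  | 0 => t = KM j \/ (j = h /\ (t = KT 0 \/ t = KT 2))
  | 1 => t = KT j /\ (0 < j)%nat | 2 => t = KP j | 3 => t = KK j
  | 4 => t = KX L j | 5 => t = KX R j | _ => t = KS j
  end%nat.
Proof.
  destruct 1; intros; subst; auto.
  - right. destruct H; subst; auto.
  - now destruct s.
Qed.

Lemma out_port_inv t f j : out_port t f j -> (f < 8)%nat ->
  match f with
  | 0 => (exists i, t = KM i /\ j = i + 1) \/ (j = 0 /\ (t = KP 8 \/ t = KK 11))
  | 1 => exists i, t = KT i /\ i < 2 /\ j = i + 1
  | 2 => exists i, t = KP i /\ j = i + 1
  | 3 => (exists i, t = KK i /\ j = i + 1) \/ (j = 0 /\ t = KS (v - 1))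
  | 4 => (exists i, t = KX L i /\ j = i + 1) \/ (j = 0 /\ t = KM 0)
  | 5 => (exists i, t = KX R i /\ j = i + 1) \/ (j = 0 /\ t = KM 0)
  | _ => (exists i, t = KS i /\ j = i + 1) \/
         (j = 0 /\ ((exists s, t = KX s (exit_length s - 1)) \/ t = KS (v + 7)))
  end%nat.
Proof.
  destruct 1; intros; subst; cbv beta iota; try (eauto; fail);
    try (destruct s; cbn; eauto; fail); right; (split; [easy|]).
  - left. exists s. f_equal. lia.
  - right. f_equal. lia.
  - f_equal. lia.
Qed.

Ltac pos_eq :=
  unfold node_pos, move; cbn [out_dir opp side_dir fst snd base feed_offset hook_offset hook_dir];
  unfold step_y, step_x; f_equal; cbn [sg]; lia.

Lemma sg_dir p s : move p (side_dir s) = (fst p + sg s, snd p).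
Proof. destruct s; cbn; f_equal; lia. Qed.

Lemma step_back p w d :
  node_pos w = move (node_pos p) d -> node_pos p = move (node_pos w) (opp d).
Proof. intros ->. destruct (node_pos p), d; cbn; f_equal; lia. Qed.

Lemma exit_pos_step D j : (S j < exit_length D)%nat ->
  node_pos (Ex D (S j)) = move (node_pos (Ex D j)) (exit_dir D (S j)).
Proof. intros H. unfold exit_dir. split_ltb; try lia; pos_eq. Qed.

Lemma stair_pos_step D i j : (S j < v + 8)%nat ->
  node_pos (St D i (S j)) = move (node_pos (St D i j)) (stair_dir (S j)).
Proof. intros H. unfold stair_dir. split_ltb; try lia; pos_eq. Qed.

Lemma feed_pos_step x j : (S j < feed_length x)%nat ->
  node_pos (Fd x (S j)) =
  move (node_pos (Fd x j)) (match x with Root => seed_dir | Step _ _ => hook_dir end (S j)).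
Proof.
  intros H. destruct x; cbn [feed_length] in H; cbn [node_pos feed_offset].
  - rewrite seed_offset_step by lia. destruct (seed_dir _); cbn; f_equal; lia.
  - rewrite hook_offset_step by lia. destruct (hook_dir _); cbn; f_equal; lia.
Qed.

Lemma exit_to_stair D j : (S j = exit_length D)%nat ->
  node_pos (St D 0 0) = move (node_pos (Ex D j)) dN.
Proof. intros H. pose proof (exit_length_ge D). destruct D; cbn [exit_length] in H; pos_eq. Qed.

Lemma stair_to_stair D i j : (S j = v + 8)%nat ->
  node_pos (St D (S i) 0) = move (node_pos (St D i j)) dN.
Proof. intros H. pos_eq. Qed.

(* The tiles under the two sides and the two return columns are those on which the
   wrong exits run aground. *)
Lemma fed_below a x z : ctx_ok a x -> fed a x ->
  (z = -2 \/ z = -1 \/ z = 1 \/ z = 2 \/ (x <> Root /\ (z = -3 \/ z = 3))) ->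
  a (fst (base x) + z, snd (base x) - 1) <> None.
Proof.
  intros Hx F H. destruct x as [|D i].
  - destruct H as [->|[->|[->|[->|[H _]]]]]; [| | | |easy];
      [refine (at_blocks _ (Fd Root 6) _ (F _ _) _)|refine (at_blocks _ (Fd Root 7) _ (F _ _) _)
      |refine (at_blocks _ (Fd Root 1) _ (F _ _) _)|refine (at_blocks _ (Fd Root 0) _ (F _ _) _)];
      cbn; (lia || easy).
  - destruct H as [->|[->|[->|[->|[_ [->| ->]]]]]];
      [refine (at_blocks _ (Fd _ 9) _ (F _ _) _)|refine (at_blocks _ (Fd _ 10) _ (F _ _) _)
      |refine (at_blocks _ (Fd _ 2) _ (F _ _) _)|refine (at_blocks _ (Fd _ 1) _ (F _ _) _)
      |refine (at_blocks _ (Fd _ 8) _ (F _ _) _)|refine (at_blocks _ (Fd _ 0) _ (F _ _) _)];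
      cbn; (lia || easy).
Qed.

(** The left face of the wall is the returning column for [L] and the first column for [R]; in both
    cases its tile [c * v - 3] lies east of the corner of the last step. *)
Lemma wall_stops_stair a D i : wall a D -> (i + 1 = c)%nat ->
  a (move (node_pos (St D i (v - 1))) dE) <> None.
Proof.
  intros (_ & W & _ & B) Hi.
  assert (8 <= c * v)%nat by nia.
  assert (E : Z.of_nat c * Z.of_nat v = Z.of_nat i * Z.of_nat v + Z.of_nat v) by (rewrite <- Hi; lia).
  destruct D.
  - refine (at_blocks _ _ _ (B (c * v - 3) ltac:(lia))%nat _). pos_eq.
  - refine (at_blocks _ _ _ (W (c * v - 3) ltac:(lia))%nat _). pos_eq.
Qed.

Lemma exit_dir_0 s : exit_dir s 0 = side_dir s.
Proof. reflexivity. Qed.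

Lemma exit_dir_1 s : exit_dir s 1 = dS.
Proof. reflexivity. Qed.

Lemma out_dir_exit s j : out_dir (exit_label s) j = exit_dir s j.
Proof. now destruct s. Qed.

Lemma in_port_exit t s j : in_port t (exit_label s) j -> t = KX s j.
Proof. intros I. apply in_port_inv in I; destruct s; cbn in *; (easy || lia). Qed.

Definition extends (a : assembly) (u : node) (t : kind) (d : dir) : Prop :=
  (exists w, child u w /\ node_pos w = move (node_pos u) d /\ node_kind w = t)
  \/ a (move (node_pos u) d) <> None.

Ltac by_child w := left; exists w; split; [|split].

(** * Growth *)

(** An out-port mostly leads to a child. In the right turn and in returning columns, which run
    against the chain, it points back at an ancestor; blocked exits meet the feed, and the last step
    meets the wall. *)
Lemma expand_out a u t f j :
  grown a u -> valid t -> out_port (node_kind u) f j -> in_port t f j ->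
  extends a u t (out_dir f j).
Proof.
  intros G V O I. pose proof h_ge6 as Hh.
  pose proof (grown_history _ _ G) as H.
  destruct u as [[|D i] k|x k|x E k|x E k|x s|x E s|D k|D i k]; cbn [node_kind history] in O, H.
  - inversion O; subst; apply in_port_inv in I; try lia.
    + subst. replace (k + 1)%nat with (S k) by lia.
      by_child (Fd Root (S k)); [constructor; cbn; lia| |easy].
      apply feed_pos_step. cbn; lia.
    + destruct I as [->|[? _]]; [|lia].
      by_child (Co Root 0); [now constructor|easy|easy].
  - inversion O; subst; apply in_port_inv in I; try lia.
    + subst. replace (k + 1)%nat with (S k) by lia.
      by_child (Fd (Step D i) (S k)); [constructor; cbn; lia| |easy].
      apply feed_pos_step. cbn; lia.
    + destruct I as [->|[? _]]; [|lia].
      by_child (Co (Step D i) 0); [now constructor|cbn; f_equal; lia|easy].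
  - inversion O; subst.
    + apply in_port_inv in I; [|lia]. destruct I as [->|[Hk [->| ->]]].
      * cbn in V. by_child (Co x (S k)); [constructor; lia|pos_eq|cbn; f_equal; lia].
      * by_child (Tp x L 0); [constructor; lia|pos_eq|easy].
      * by_child (Tp x R 0); [constructor; lia|pos_eq|easy].
    + apply in_port_exit in I. subst. rewrite out_dir_exit, exit_dir_0.
      by_child (Sc x s); [constructor|rewrite sg_dir; cbn; f_equal; lia|easy].
  - destruct H as (_ & Hk & _ & _ & H). destruct E; cbn [node_kind] in O.
    + inversion O; subst. apply in_port_inv in I; [|lia]. destruct I as [-> _].
      by_child (Tp x L (S k)); [constructor; lia|pos_eq|cbn; f_equal; lia].
    (* The right turn passes through the chain backwards, so its out-ports face tiles already
       placed. *)
    + right. clear I V. destruct k as [|[|[|k]]]; [| | |lia]; inversion O; subst; try lia.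
      * apply (at_blocks _ (Tp x R 0)); [apply H; lia|pos_eq].
      * apply (at_blocks _ (Tp x R 1)); [apply H; lia|pos_eq].
  - destruct H as (Hx & Hk & _ & _ & T & H). inversion O; subst.
    + right. destruct (Nat.eq_dec (k + 1) h).
      * apply (at_blocks _ (Tp x E 2)); [apply T; lia|pos_eq].
      * apply (at_blocks _ (Re x E (k + 1))); [apply H; lia|pos_eq].
    + apply in_port_exit in I. subst. rewrite out_dir_exit, exit_dir_0.
      assert (D : (x = Root /\ s = E) \/ ~ (x = Root /\ s = E)).
      { destruct x, s, E; (left; split; congruence) || (right; intros [? ?]; congruence). }
      destruct D as [[-> ->]|D].
      * by_child (Ex E 0); [constructor|now destruct E|easy].
      * by_child (Sr x E s); [now constructor|rewrite sg_dir; cbn [node_pos fst snd]; f_equal; lia|easy].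
  - destruct H as (Hx & F & _). right. pose proof (exit_length_ge s).
    inversion O; subst; [|lia]. rewrite out_dir_exit. cbn [Nat.add]. rewrite exit_dir_1.
    cbn [move node_pos fst snd]. apply fed_below; [easy|easy|destruct s; cbn; lia].
  - destruct H as (Hx & F & _ & _ & N). right. pose proof (exit_length_ge s).
    inversion O; subst; [|lia]. rewrite out_dir_exit. cbn [Nat.add]. rewrite exit_dir_1.
    cbn [move node_pos fst snd]. rewrite <- Z.add_assoc. apply fed_below; [easy|easy|].
    destruct x, s, E; cbn [sg]; try lia; try (now destruct N);
      do 4 right; split; (discriminate || lia).
  - inversion O; subst.
    + apply in_port_exit in I. subst. rewrite out_dir_exit, Nat.add_1_r.
      by_child (Ex D (S k)); [constructor; lia| |easy].
      apply exit_pos_step; lia.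
    + apply in_port_inv in I; [|lia]. subst. replace (out_dir 6 0) with dN.
      * by_child (St D 0 0); [apply ch_Ex_St with (j := k); lia|apply exit_to_stair; lia|easy].
      * cbn. unfold stair_dir. split_ltb; (easy || lia).
  - destruct H as (W & Hi & Hk & Hc). inversion O; subst.
    + apply in_port_inv in I; [|lia]. subst. cbn [out_dir]. rewrite Nat.add_1_r.
      destruct (Nat.lt_ge_cases (S i) c) as [Hi'|Hi'].
      * by_child (St D i (S k)); [constructor; lia| |easy].
        apply stair_pos_step; lia.
      * destruct (Nat.lt_ge_cases (S k) v) as [Hk'|Hk'].
        -- by_child (St D i (S k)); [constructor; lia| |easy].
           apply stair_pos_step; lia.
        (* Here [k = v - 1] on the last step, whose east side faces the wall. *)
        -- right. replace (stair_dir (S k)) with dE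
             by (unfold stair_dir; split_ltb; (easy || lia)).
           replace k with (v - 1)%nat by lia. apply wall_stops_stair; [easy|lia].
    + apply in_port_inv in I; [|lia]. subst. replace (out_dir 6 0) with dN.
      * by_child (St D (S i) 0); [apply ch_St_St with (j := k); lia| |easy].
        apply stair_to_stair; lia.
      * cbn. unfold stair_dir. split_ltb; (easy || lia).
    + apply in_port_inv in I; [|lia]. subst.
      by_child (Fd (Step D i) 0); [apply ch_St_Fd with (j := k); lia|pos_eq|easy].
Qed.

(** An in-port mostly faces the parent. In the right turn and in returning columns it faces the next
    node instead. *)
Lemma expand_in a u t f j :
  grown a u -> in_port (node_kind u) f j -> out_port t f j ->
  extends a u t (opp (out_dir f j)).
Proof.
  intros G I O. pose proof h_ge6 as Hh.
  pose proof (grown_history _ _ G) as H.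
  assert (P : match u with Fd Root _ => True | _ => exists p, child p u /\ at_node a p end).
  { destruct G as [|p u Gp C _]; [easy|]. apply grown_at in Gp.
    destruct u as [[|]| | | | | | |]; eauto. }
  destruct u as [[|D i] k|x k|x E k|x E k|x s|x E s|D k|D i k]; cbn [node_kind history] in I, H.
  - right. inversion I; subst. destruct j as [|j]; [lia|].
    apply (at_blocks _ (Fd Root j)); [apply H; lia|].
    apply step_back, feed_pos_step, H.
  - right. inversion I; subst. destruct j as [|j].
    + destruct P as (p & C & A). apply (at_blocks _ p); [easy|].
      inversion C; subst. pos_eq.
    + apply (at_blocks _ (Fd (Step D i) j)); [apply H; lia|].
      apply step_back, feed_pos_step, H.
  - right. inversion I; subst. destruct H as (Hx & Hk & F & H). destruct j as [|j].
    + apply (at_blocks _ (Fd x (feed_length x - 1))); [apply F; destruct x; cbn; lia|].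
      destruct x; cbn; f_equal; lia.
    + apply (at_blocks _ (Co x j)); [apply H; lia|pos_eq].
  - destruct H as (Hx & Hk & F & W & H). destruct E; cbn [node_kind] in I.
    + inversion I; subst.
      * destruct k as [|[|[|k]]]; try lia.
        -- right. apply (at_blocks _ (Co x (h - 1))); [apply W; lia|pos_eq].
        -- apply out_port_inv in O; [|lia]. destruct O as [(i & -> & Hi)|[Hi _]]; [|lia].
           by_child (Re x L i); [constructor; lia|pos_eq|easy].
      * right. apply (at_blocks _ (Tp x L (j - 1))); [apply H; lia|pos_eq].
    + inversion I; subst.
      * destruct k as [|[|[|k]]]; try lia.
        -- right. apply (at_blocks _ (Co x (h - 1))); [apply W; lia|pos_eq].
        -- apply out_port_inv in O; [|lia]. destruct O as [(i & -> & Hi)|[Hi _]]; [|lia].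
           by_child (Re x R i); [constructor; lia|pos_eq|easy].
      * apply out_port_inv in O; [|lia]. destruct O as (i & -> & Hi & Hi').
        destruct k as [|[|[|k]]]; [| |lia|lia].
        -- by_child (Tp x R 1); [constructor; lia|pos_eq|cbn in *; f_equal; lia].
        -- by_child (Tp x R 2); [constructor; lia|pos_eq|cbn in *; f_equal; lia].
  - destruct H as (Hx & Hk & F & W & T & H). inversion I; subst. destruct j as [|j].
    (* The foot of a returning column could bind the last feed or hook tile from below, but that
       cell already belongs to the feed. *)
    + right. cbn [out_dir opp move node_pos fst snd]. rewrite Z.add_0_r.
      apply fed_below; [easy|easy|destruct E; cbn; lia].
    + apply out_port_inv in O; [|lia]. destruct O as [(i & -> & Hi)|[Hi _]]; [|lia].
      by_child (Re x E i); [replace (S j) with (S i) by lia; constructor|pos_eq|easy].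
  - right. destruct H as (Hx & F & A). inversion I; subst. rewrite out_dir_exit, exit_dir_0.
    apply (at_blocks _ (Co x 0)); [easy|]. destruct s; pos_eq.
  - right. destruct H as (Hx & F & A & _). inversion I; subst. rewrite out_dir_exit, exit_dir_0.
    apply (at_blocks _ (Re x E 0)); [easy|]. destruct s; pos_eq.
  - right. destruct P as (p & C & A). apply (at_blocks _ p); [easy|].
    inversion I; subst. rewrite out_dir_exit. inversion C; subst.
    + destruct D; reflexivity.
    + apply step_back, exit_pos_step. lia.
  - right. destruct P as (p & C & A). apply (at_blocks _ p); [easy|].
    inversion I; subst. cbn [out_dir].
    assert (E0 : stair_dir 0 = dN) by (unfold stair_dir; split_ltb; (easy || lia)).
    inversion C; subst.
    + rewrite E0. apply step_back, exit_to_stair. lia.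
    + apply step_back, stair_pos_step. lia.
    + rewrite E0. apply step_back, stair_to_stair. lia.
Qed.

Lemma expand a u t d :
  grown a u -> valid t -> glue d (node_kind u) = glue (opp d) t ->
  glue d (node_kind u) <> 0%nat -> extends a u t d.
Proof.
  intros G V E N.
  destruct (glue_match _ _ _ (grown_valid _ _ G) V E N) as (f & j & [(O & I & ->)|(I & O & ->)]).
  - now apply expand_out.
  - now apply expand_in.
Qed.

Lemma tile_glue_kind d k : tile_glue d (kind_tile k) = glue d k.
Proof. now destruct d. Qed.

Definition all_grown (a : assembly) : Prop :=
  forall q t, a q = Some t -> exists u, grown a u /\ node_pos u = q.

Lemma grown_mono a b u :
  (forall q t, a q = Some t -> b q = Some t) -> grown a u -> grown b u.
Proof.
  intros M. induction 1 as [H|u w G IH C H].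
  - constructor. now apply M.
  - apply grown_child with u; auto. now apply M.
Qed.

(** Induction on the steps: a new tile binds to a grown node, and since its cell was empty, [expand]
    leaves only the case of a child. *)
Lemma fin_producible_grown a : fin_producible system a -> all_grown a.
Proof.
  induction 1 as [a E|a b P IH (p & t & T & A & E)].
  - intros q t H. rewrite E in H. unfold seed in H. cbn in H.
    destruct (Z.eqb_spec (fst q) 2); [|easy].
    destruct (Z.eqb_spec (snd q) (-1)); [|easy].
    exists (Fd Root 0). split; [|destruct q; cbn in *; congruence].
    constructor. unfold at_node. rewrite E. now unfold seed.
  - apply attachable_spec in A as (N & q & d & u' & A & -> & B & Z).
    assert (Eq : forall r, b r = if (fst r =? fst (move q d)) && (snd r =? snd (move q d))
                 then Some t else a r) by exact E.
    assert (Bp : b (move q d) = Some t) by now rewrite Eq, !Z.eqb_refl.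
    assert (M : forall r s, a r = Some s -> b r = Some s).
    { intros r s H. rewrite Eq. destruct ((_ =? _) && _) eqn:D; [|easy].
      apply andb_prop in D as [D1 D2]. apply Z.eqb_eq in D1, D2.
      destruct r; rewrite (surjective_pairing (move q d)) in N; cbn [fst snd] in D1, D2.
      congruence. }
    destruct (IH q u' A) as (u & G & <-).
    assert (u' = kind_tile (node_kind u)) as ->.
    { pose proof (grown_at _ _ G) as H. unfold at_node in H. congruence. }
    apply in_tiles in T as (k & V & <-). rewrite !tile_glue_kind in *.
    intros r s H.
    destruct (expand a u k d G V B Z) as [(w & C & Pw & Kw)|X]; [|now rewrite N in X].
    rewrite Eq in H. destruct ((_ =? _) && _) eqn:D.
    + apply andb_prop in D as [D1 D2]. apply Z.eqb_eq in D1, D2.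
      exists w. split.
      * apply grown_child with u; [exact (grown_mono _ _ _ M G)|easy|].
        unfold at_node. now rewrite Pw, Kw.
      * rewrite Pw. destruct r; rewrite (surjective_pairing (move _ d)); cbn [fst snd] in *.
        congruence.
    + destruct (IH r s H) as (w' & G' & Pw'). exists w'. split; [|easy].
      exact (grown_mono _ _ _ M G').
Qed.

Lemma producible_grown a : producible system a -> all_grown a.
Proof.
  intros (f & P & _ & A) q t H. apply A in H as [i H].
  destruct (fin_producible_grown _ (P i) q t H) as (u & G & E).
  exists u. split; [|easy]. apply grown_mono with (f i); [|easy].
  intros r s Hr. apply A. eauto.
Qed.

(** * Bounds on the assembly *)

(* Linearizes the products with the step height for lia. *)
Lemma rows i i' : i = i' \/
  (i < i')%nat /\ Z.of_nat i * Z.of_nat v + Z.of_nat v <= Z.of_nat i' * Z.of_nat v \/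
  (i' < i)%nat /\ Z.of_nat i' * Z.of_nat v + Z.of_nat v <= Z.of_nat i * Z.of_nat v.
Proof.
  destruct (Nat.lt_total i i') as [|[|]]; [right; left|left|right; right]; try easy;
    (split; [easy|nia]).
Qed.

Lemma feed_offset_range x j :
  -3 <= fst (feed_offset x j) <= 3 /\ -2 <= snd (feed_offset x j) <= -1 /\
  (x = Root -> -2 <= fst (feed_offset x j) <= 2).
Proof.
  destruct x; cbn [feed_offset].
  - do 8 (destruct j as [|j]; [cbn; lia|]); cbn; lia.
  - do 11 (destruct j as [|j]; [cbn; (split; [lia|split; [lia|easy]])|]); cbn;
      (split; [lia|split; [lia|easy]]).
Qed.

Lemma feed_offset_inj x j j' : (j < feed_length x)%nat -> (j' < feed_length x)%nat ->
  feed_offset x j = feed_offset x j' -> j = j'.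
Proof.
  destruct x; cbn [feed_offset feed_length]; intros H H' E.
  - do 9 (destruct j as [|j]; [do 9 (destruct j' as [|j']; [easy|]); lia|]); lia.
  - do 12 (destruct j as [|j]; [do 12 (destruct j' as [|j']; [easy|]); lia|]); lia.
Qed.

(** The row of the turn above the column of the last step: [step_y (c - 1) + v + 1 + h]. *)
Definition top : Z := Z.of_nat c * Z.of_nat v + Z.of_nat h - 2.

Lemma grown_bounds a u : grown a u ->
  - (8 * Z.of_nat c + 20) <= fst (node_pos u) <= 20 /\ -3 <= snd (node_pos u) <= top.
Proof.
  intros G. apply grown_history in G. pose proof h_ge6. unfold top.
  assert (B : forall i, (i < c)%nat -> 0 <= Z.of_nat i * Z.of_nat v /\
    Z.of_nat i * Z.of_nat v + Z.of_nat v <= Z.of_nat c * Z.of_nat v).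
  { intros i Hi. split; [nia|]. destruct (rows i c) as [|[|]]; lia. }
  assert (Bx : forall x, ctx_ok a x -> - (8 * Z.of_nat c + 10) <= fst (base x) <= 0 /\
    0 <= snd (base x) <= Z.of_nat c * Z.of_nat v - 2).
  { intros [|D i] Hx; cbn [base fst snd].
    - destruct (B 0%nat ltac:(lia)). lia.
    - destruct Hx as [_ Hi]. specialize (B i Hi). unfold step_x, step_y.
      destruct D; cbn [sg]; lia. }
  assert (C0 : 8 <= Z.of_nat c * Z.of_nat v) by nia.
  destruct u as [x j|x j|x E j|x E j|x s|x E s|D j|D i j]; cbn [history node_pos fst snd] in *;
    try (specialize (Bx x (proj1 G))).
  - pose proof (feed_offset_range x j). lia.
  - lia.
  - destruct E; cbn [sg]; lia.
  - destruct E; cbn [sg]; lia.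
  - destruct s; cbn [sg]; lia.
  - destruct E, s; cbn [sg]; lia.
  - destruct G as [_ G]. destruct D; cbn [sg exit_length] in *; lia.
  - destruct G as (_ & Hi & Hj & _). specialize (B i Hi). unfold step_x, step_y.
    destruct D; cbn [sg]; lia.
Qed.

(** The converse of [expand]: every edge of the tree is a bond between abutting tiles, so a child
    can attach whenever its cell is free. *)
Lemma child_adjacent a u w : grown a u -> child u w ->
  exists d, node_pos w = move (node_pos u) d /\
    exists f j, (out_port (node_kind u) f j /\ in_port (node_kind w) f j /\ d = out_dir f j) \/
                (in_port (node_kind u) f j /\ out_port (node_kind w) f j /\ d = opp (out_dir f j)).
Proof.
  intros G C. apply grown_history in G. pose proof h_ge6 as Hh.
  assert (S0 : out_dir 6 0 = dN) by (cbn; unfold stair_dir; split_ltb; (easy || lia)).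
  destruct C as [x j H|x j H|x j H|x E j H|x E j H|x E j H|x E j|x s|x E s N|D|D j H|D j H
                |D i j H Hc|D i j H Hc|D i j H].
  - eexists. split; [apply feed_pos_step; lia|].
    destruct x; cbn in H; [exists 2%nat|exists 3%nat]; exists (S j); left;
      (repeat split; [constructor; lia|constructor; lia]).
  - exists dN. destruct x; cbn in H.
    + replace j with 8%nat by lia. split; [easy|]. exists 0%nat, 0%nat. left.
      repeat split; constructor.
    + replace j with 11%nat by lia. split; [cbn; f_equal; lia|]. exists 0%nat, 0%nat. left.
      repeat split; constructor.
  - exists dN. split; [pos_eq|]. exists 0%nat, (S j). left. repeat split; constructor; lia.
  - exists dN. split; [destruct E; pos_eq|]. exists 0%nat, h. left.
    destruct E; (repeat split; constructor; auto; lia).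
  - exists (side_dir E). split; [rewrite sg_dir; cbn [node_pos fst snd]; f_equal; lia|].
    destruct E; cbn [node_kind].
    + exists 1%nat, (S j). left. repeat split; constructor; lia.
    + exists 1%nat, (2 - j)%nat. right. repeat split; constructor; lia.
  - exists dS. split; [pos_eq|]. exists 0%nat, h. right.
    destruct E; (repeat split; constructor; auto; lia).
  - exists dS. split; [pos_eq|]. exists 0%nat, (S j). right. repeat split; constructor; lia.
  - exists (side_dir s). split; [rewrite sg_dir; cbn [node_pos fst snd]; f_equal; lia|].
    exists (exit_label s), 0%nat. left.
    rewrite out_dir_exit. split; [now apply out_M_X with s|split; [now constructor|easy]].
  - exists (side_dir s). split; [rewrite sg_dir; cbn [node_pos fst snd]; f_equal; lia|].
    exists (exit_label s), 0%nat. left.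
    rewrite out_dir_exit. split; [now apply out_M_X with s|split; [now constructor|easy]].
  - exists (side_dir D). split; [now destruct D|].
    exists (exit_label D), 0%nat. left.
    rewrite out_dir_exit. split; [now apply out_M_X with D|split; [now constructor|easy]].
  - eexists. split; [apply exit_pos_step; lia|].
    exists (exit_label D), (S j). left. rewrite out_dir_exit.
    split; [constructor; (easy || lia)|split; [now constructor|easy]].
  - exists dN. split; [apply exit_to_stair; lia|]. exists 6%nat, 0%nat. left. rewrite S0.
    split; [apply out_X_S; lia|split; [constructor|easy]].
  - eexists. split; [apply stair_pos_step; lia|]. exists 6%nat, (S j). left.
    repeat split; constructor; lia.
  - exists dN. split; [apply stair_to_stair; lia|]. exists 6%nat, 0%nat. left. rewrite S0.
    split; [apply out_S_S; lia|split; [constructor|easy]].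
  - exists dW. split; [pos_eq|]. exists 3%nat, 0%nat. left.
    split; [apply out_S_K; lia|split; [constructor|easy]].
Qed.

(** * Completeness of terminal assemblies *)

Definition stuck (a : assembly) : Prop :=
  forall p t, In t (tiles system) -> ~ attachable a p t.

Lemma child_occupied a u w :
  stuck a -> grown a u -> child u w -> valid (node_kind w) -> a (node_pos w) <> None.
Proof.
  intros T G C V N. destruct (child_adjacent a u w G C) as (d & P & f & j & H).
  pose proof (grown_valid _ _ G) as Vu.
  assert (E : glue d (node_kind u) = label f j /\ glue (opp d) (node_kind w) = label f j).
  { destruct H as [(O & I & ->)|(I & O & ->)]; rewrite ?opp_opp;
      split; auto using out_port_glue, in_port_glue. }
  apply (T (node_pos w) (kind_tile (node_kind w))); [apply in_tiles; eauto|].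
  apply attachable_spec. split; [easy|].
  exists (node_pos u), d, (kind_tile (node_kind u)).
  split; [exact (grown_at _ _ G)|]. split; [easy|].
  rewrite !tile_glue_kind. destruct E as [-> ->]. split; [easy|]. unfold label; lia.
Qed.

(* The turn at the top of the first column may go either way; a node that lies beyond it
   belongs to the world of that choice. *)
Definition in_world (D : side) (u : node) : Prop :=
  match u with
  | Fd (Step D' _) _ | Co (Step D' _) _ | Tp (Step D' _) _ _ | Re (Step D' _) _ _
  | Sc (Step D' _) _ | Sr (Step D' _) _ _
  | Tp Root D' _ | Re Root D' _ | Sr Root D' _ | Ex D' _ | St D' _ _ => D' = D
  | _ => True
  end.

(* The part of the tree that is shown to be always present: it leads to the top of the
   assembly. *)
Definition on_trunk (u : node) : Prop :=
  match u with
  | Fd (Step _ i) _ | Co (Step _ i) _ => (S i = c)%nat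
  | Tp (Step _ _) _ _ | Re (Step _ _) _ _ | Sc _ _ | Sr _ _ _ => False
  | _ => True
  end.

(** * Trunk nodes share no cell with other nodes of their world *)

Lemma stair_range D i j : in_range (St D i j) ->
  step_x D i <= fst (node_pos (St D i j)) <= sg D - 2 /\
  ((j < v)%nat /\ fst (node_pos (St D i j)) = step_x D i /\
     snd (node_pos (St D i j)) = step_y i + Z.of_nat j + 1 \/
   (v <= j)%nat /\ (S i < c)%nat /\ snd (node_pos (St D i j)) = step_y i + Z.of_nat v /\
     fst (node_pos (St D i j)) = step_x D i + Z.of_nat j + 1 - Z.of_nat v).
Proof.
  cbn [in_range node_pos fst snd]. intros (Hi & Hj & H).
  unfold step_x. destruct D; cbn [sg]; lia.
Qed.

Definition step_ctx (u : node) : option (side * nat) :=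
  match u with
  | Fd (Step D i) _ | Co (Step D i) _ | Tp (Step D i) _ _ | Re (Step D i) _ _
  | Sc (Step D i) _ | Sr (Step D i) _ _ => Some (D, i)
  | _ => None
  end.

Lemma step_world D D' i u : step_ctx u = Some (D', i) -> in_world D u -> D' = D.
Proof.
  destruct u as [[|] ?|[|] ?|[|] ? ?|[|] ? ?|[|] ?|[|] ? ?|? ?|? ? ?]; cbn; congruence.
Qed.

Definition at_root (u : node) : Prop :=
  match u with
  | Fd Root _ | Co Root _ | Tp Root _ _ | Re Root _ _ | Sc Root _ | Sr Root _ _ | Ex _ _ => True
  | _ => False
  end.

Lemma step_range D i u : in_range u -> step_ctx u = Some (D, i) ->
  (i < c)%nat /\ step_x D i - 7 <= fst (node_pos u) <= step_x D i - 1 /\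
  step_y i + Z.of_nat v - 1 <= snd (node_pos u).
Proof.
  intros V H.
  destruct u as [[|D' i'] j|[|D' i'] j|[|D' i'] E j|[|D' i'] E j|[|D' i'] s|[|D' i'] E s|D' j|D' i' j];
    try easy; injection H as -> ->;
    cbn [in_range ctx_in_range node_pos base fst snd] in *.
  - pose proof (feed_offset_range (Step D i) j). lia.
  - lia.
  - destruct E; cbn [sg]; lia.
  - destruct E; cbn [sg]; lia.
  - destruct s; cbn [sg]; lia.
  - destruct E, s; cbn [sg]; lia.
Qed.

(** Above row 0 the root part stays at or right of the left face of the wall, [sg D - 1]; in row 0
    an exit may protrude by one cell. *)
Lemma root_range D u : in_range u -> at_root u -> in_world D u ->
  (-3 <= snd (node_pos u) <= -1 /\ (-2 <= fst (node_pos u) <= 2 \/ fst (node_pos u) = 3 * sg D) \/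
   snd (node_pos u) = -3) \/
  0 <= snd (node_pos u) /\ (sg D - 1 <= fst (node_pos u) \/
    snd (node_pos u) = 0 /\ sg D - 2 <= fst (node_pos u)).
Proof.
  intros V H W.
  destruct u as [[|D' i'] j|[|D' i'] j|[|D' i'] E j|[|D' i'] E j|[|D' i'] s|[|D' i'] E s|D' j|D' i' j];
    try easy; cbn [in_world] in W; subst; cbn [in_range] in V;
    cbn [node_pos base fst snd].
  - destruct (feed_offset_range Root j) as (_ & ? & F). specialize (F eq_refl). lia.
  - destruct D; cbn [sg]; lia.
  - destruct D; cbn [sg]; lia.
  - destruct D; cbn [sg]; lia.
  - destruct D, s; cbn [sg]; lia.
  - destruct D, s; cbn [sg]; try lia; exfalso; now apply V.
  - destruct (Nat.le_gt_cases j 3); [|lia].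
    replace (j - 3)%nat with 0%nat by lia. destruct D; cbn [sg]; lia.
Qed.

Lemma step_x_le D i : (i < c)%nat -> step_x D i <= sg D - 2.
Proof. unfold step_x. lia. Qed.

Lemma step_y_ge i : i = 0%nat /\ step_y i = -3 \/ (0 < i)%nat /\ Z.of_nat v - 3 <= step_y i.
Proof. unfold step_y. destruct (rows i 0) as [->|[|]]; lia. Qed.

Lemma root_step_disjoint D D' i u w :
  in_range u -> in_range w -> at_root u -> step_ctx w = Some (D', i) ->
  in_world D u -> in_world D w -> node_pos u <> node_pos w.
Proof.
  intros Vu Vw Hu Hw Wu Ww E.
  pose proof (step_world _ _ _ _ Hw Ww). subst D'.
  pose proof (step_range _ _ _ Vw Hw). pose proof (root_range _ _ Vu Hu Wu).
  rewrite E in *. pose proof (step_y_ge i). pose proof (step_x_le D i). lia.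
Qed.

Lemma root_stair_disjoint D i j u :
  in_range u -> in_range (St D i j) -> at_root u -> in_world D u ->
  node_pos u <> node_pos (St D i j).
Proof.
  intros Vu Vw Hu Wu E.
  pose proof (stair_range _ _ _ Vw) as H. pose proof (root_range _ _ Vu Hu Wu) as H'.
  cbn [in_range] in Vw. rewrite E in *. pose proof (step_y_ge i).
  unfold step_x in H. destruct D; cbn [sg] in *; lia.
Qed.

Lemma step_stair_disjoint D D' i i' j u :
  in_range u -> in_range (St D i' j) -> step_ctx u = Some (D', i) -> in_world D u ->
  node_pos u <> node_pos (St D i' j).
Proof.
  intros Vu Vw Hu Wu E.
  pose proof (step_world _ _ _ _ Hu Wu). subst D'.
  pose proof (stair_range _ _ _ Vw) as H. pose proof (step_range _ _ _ Vu Hu) as H'.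
  rewrite E in H'. cbn [in_range] in Vw. unfold step_x, step_y in *.
  destruct H as [_ [(Hj & Hx & _)|(Hj & _ & Hy & Hx)]]; [lia|].
  (* The only horizontal run in the columns of hook [i] is that of the preceding step, and it lies
     below the hook. *)
  assert (i = S i') as -> by lia. lia.
Qed.

Lemma stair_inj D i j i' j' : in_range (St D i j) -> in_range (St D i' j') ->
  node_pos (St D i j) = node_pos (St D i' j') -> St D i j = St D i' j'.
Proof.
  intros V V' E.
  pose proof (stair_range _ _ _ V) as H. pose proof (stair_range _ _ _ V') as H'.
  rewrite E in H. cbn [in_range] in V, V'. unfold step_x, step_y in *.
  assert (i = i' /\ j = j') as [-> ->]; [|easy].
  destruct H as [_ [(Hj & Hx & Hy)|(Hj & Hc & Hy & Hx)]];
    destruct H' as [_ [(Hj' & Hx' & Hy')|(Hj' & Hc' & Hy' & Hx')]]; rewrite Hx in Hx'; rewrite Hy in Hy'.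
  - assert (i = i') as -> by lia. lia.
  - assert (i = S i') as -> by lia. lia.
  - assert (i' = S i) as -> by lia. lia.
  - lia.
Qed.

Lemma root_inj D u w : in_range u -> in_range w -> at_root u -> at_root w ->
  in_world D u -> in_world D w -> on_trunk w -> node_pos u = node_pos w -> u = w.
Proof.
  intros Vu Vw Hu Hw Wu Ww T E.
  destruct w as [[|] k|[|] k|[|] F k|[|] F k|[|] t|[|] F t|F k|F k l]; try easy;
  destruct u as [[|] j|[|] j|[|] G j|[|] G j|[|] s|[|] G s|G j|G i j]; try easy;
    cbn [in_world] in Wu, Ww; subst;
    try (destruct (feed_offset_range Root k) as (_ & ? & Fk); specialize (Fk eq_refl));
    try (destruct (feed_offset_range Root j) as (_ & ? & Fj); specialize (Fj eq_refl));
    cbn [in_range] in Vu, Vw; unfold node_pos in E; pose proof (f_equal fst E) as E1; pose proof (f_equal snd E) as E2;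
    cbn [base fst snd feed_offset] in *; try (f_equal; lia);
    try (exfalso; destruct D; cbn [sg] in *; lia);
    try (f_equal; destruct D; cbn [sg] in *; lia);
    try (exfalso; destruct D, s; cbn [sg] in *; try lia; now apply Vu).
  (* Only the case of two feed tiles is left. *)
  f_equal. apply (feed_offset_inj Root); [easy|easy|].
  cbn [feed_offset]. rewrite (surjective_pairing (seed_offset j)), (surjective_pairing (seed_offset k)).
  f_equal; lia.
Qed.

Lemma step_inj D i u w : in_range u -> in_range w ->
  step_ctx u = Some (D, i) -> step_ctx w = Some (D, i) -> on_trunk w ->
  node_pos u = node_pos w -> u = w.
Proof.
  intros Vu Vw Hu Hw T E.
  destruct w as [[|] k|[|] k|[|] F k|[|] F k|[|] t|[|] F t|F k|F k l]; try easy;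
  destruct u as [[|] j|[|] j|[|] G j|[|] G j|[|] s|[|] G s|G j|G i' j]; try easy;
    injection Hu as -> ->; injection Hw as -> ->;
    try (pose proof (feed_offset_range (Step D i) k));
    try (pose proof (feed_offset_range (Step D i) j));
    cbn [in_range] in Vu, Vw; unfold node_pos in E; pose proof (f_equal fst E) as E1; pose proof (f_equal snd E) as E2;
    cbn [base fst snd feed_offset] in *; try (f_equal; lia);
    try (exfalso; lia);
    try (exfalso; destruct G; cbn [sg] in *; lia);
    try (exfalso; destruct s; cbn [sg] in *; lia);
    try (exfalso; destruct G, s; cbn [sg] in *; lia).
  f_equal. apply (feed_offset_inj (Step D i)); [easy|easy|].
  cbn [feed_offset]. rewrite (surjective_pairing (hook_offset j)), (surjective_pairing (hook_offset k)).
  f_equal; lia.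
Qed.

Lemma node_cases u : at_root u \/ (exists D i, step_ctx u = Some (D, i)) \/
  exists D i j, u = St D i j.
Proof.
  destruct u as [[|] ?|[|] ?|[|] ? ?|[|] ? ?|[|] ?|[|] ? ?|? ?|? ? ?]; cbn; eauto 6.
Qed.

(** Separates by horizontal range first and by height where the ranges meet. Only [w] is on the
    trunk: off it, cells can be shared, for instance by the two possible turns of a later column or
    by an inner exit [Sr] and an exit [Sc]. *)
Lemma overlap D u w : in_range u -> in_range w -> in_world D u -> in_world D w ->
  on_trunk w -> node_pos u = node_pos w -> u = w.
Proof.
  intros Vu Vw Wu Ww T E.
  destruct (node_cases u) as [Hu|[(Du & iu & Hu)|(Du & iu & ju & ->)]];
  destruct (node_cases w) as [Hw|[(Dw & iw & Hw)|(Dw & iw & jw & ->)]];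
    cbn [in_world] in Wu, Ww; subst.
  - now apply (root_inj D).
  - now destruct (root_step_disjoint D _ _ u w Vu Vw Hu Hw Wu Ww).
  - now destruct (root_stair_disjoint D iw jw u Vu Vw Hu Wu).
  - now destruct (root_step_disjoint D _ _ w u Vw Vu Hw Hu Ww Wu).
  - pose proof (step_world _ _ _ _ Hu Wu). pose proof (step_world _ _ _ _ Hw Ww). subst Du Dw.
    pose proof (step_range _ _ _ Vu Hu) as Ru. pose proof (step_range _ _ _ Vw Hw) as Rw.
    rewrite E in Ru. unfold step_x in *. assert (iu = iw) as -> by lia.
    now apply (step_inj D iw).
  - now destruct (step_stair_disjoint D Du iu iw jw u Vu Vw Hu Wu).
  - now destruct (root_stair_disjoint D iu ju w Vw Vu Hw Ww).
  - now destruct (step_stair_disjoint D Dw iw iu ju w Vw Vu Hw Ww).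
  - now apply stair_inj.
Qed.

(** For nodes common to both worlds the value [L] is arbitrary. *)
Definition world (u : node) : side :=
  match u with
  | Fd (Step D _) _ | Co (Step D _) _ | Tp (Step D _) _ _ | Re (Step D _) _ _
  | Sc (Step D _) _ | Sr (Step D _) _ _
  | Tp Root D _ | Re Root D _ | Sr Root D _ | Ex D _ | St D _ _ => D
  | _ => L
  end.

Lemma in_own_world u : in_world (world u) u.
Proof. now destruct u as [[|] ?|[|] ?|[|] ? ?|[|] ? ?|[|] ?|[|] ? ?|? ?|? ? ?]. Qed.

(** * The trunk is present in every terminal assembly *)

Lemma turn_unique a D D' :
  at_node a (Tp Root D 0) -> at_node a (Tp Root D' 0) -> D = D'.
Proof.
  unfold at_node. intros H H'.
  assert (P : node_pos (Tp Root D 0) = node_pos (Tp Root D' 0)) by (cbn; f_equal; lia).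
  rewrite P, H' in H. injection H as H.
  assert (K : forall F, valid (node_kind (Tp Root F 0))) by (destruct F; cbn; lia).
  destruct D, D'; try easy;
    apply (kind_tile_inj (node_kind (Tp Root _ 0)) (node_kind (Tp Root _ 0)) (K _) (K _)) in H;
    discriminate.
Qed.

(** The ancestors of a node beyond the first turn contain that turn, and [turn_unique] allows only
    one. *)
Lemma grown_in_world a D u : at_node a (Tp Root D 0) -> grown a u -> in_world D u.
Proof.
  intros A G. apply grown_history in G.
  assert (W : forall D', wall a D' -> D' = D).
  { intros D' (_ & _ & T & _). apply (turn_unique a); [apply T; lia|easy]. }
  destruct u as [[|D' i] j|[|D' i] j|[|D' i] E j|[|D' i] E j|[|D' i] s|[|D' i] E s|D' j|D' i j];
    cbn [history ctx_ok in_world] in *; try easy; try (now apply W);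
    apply (turn_unique a); try easy.
  - apply G; lia.
  - destruct G as (_ & _ & _ & _ & T & _). apply T; lia.
  - destruct G as (_ & _ & _ & T & _). apply T; lia.
Qed.

(** The cell of [w] is occupied, by a tile of some grown node; by [overlap] this node is [w]
    itself. *)
Lemma trunk_grows a u w :
  stuck a -> all_grown a ->
  (forall u', grown a u' -> exists D, in_world D u' /\ in_world D w) ->
  grown a u -> child u w -> in_range w -> on_trunk w -> grown a w.
Proof.
  intros T A W G C V K.
  pose proof (child_occupied _ _ _ T G C (in_range_valid _ V)) as N.
  destruct (a (node_pos w)) as [t|] eqn:E; [|easy].
  destruct (A _ _ E) as (u' & G' & P). destruct (W u' G') as (D & Wu & Ww).
  now rewrite <- (overlap D u' w (grown_in_range _ _ G') V Wu Ww K P).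
Qed.

Lemma producible_seed a : producible system a -> at_node a (Fd Root 0).
Proof.
  intros (f & P & _ & A). apply A. exists 0%nat.
  induction (P 0%nat) as [b E|b b' _ IH (p & t & _ & Att & E)].
  - rewrite E. reflexivity.
  - rewrite E. destruct (_ && _) eqn:D; [|easy].
    apply andb_prop in D as [D1 D2]. apply Z.eqb_eq in D1, D2.
    destruct p as [x y], Att as [N _]. cbn [fst snd] in D1, D2. subst x y.
    change (fst (node_pos (Fd Root 0)), snd (node_pos (Fd Root 0)))
      with (node_pos (Fd Root 0)) in N. congruence.
Qed.

Lemma first_column_grows a j :
  stuck a -> all_grown a -> at_node a (Fd Root 0) -> (j < h)%nat -> grown a (Co Root j).
Proof.
  intros T A S0. pose proof h_ge6.
  assert (step : forall u w, grown a u -> child u w -> in_range w -> on_trunk w ->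
                 (forall D, in_world D w) -> grown a w).
  { intros u w G C V K W. apply trunk_grows with u; auto.
    (* Before the turn, [w] lies in both worlds, so the world of [u'] can be used. *)
    intros u' _. exists (world u'). split; [apply in_own_world|easy]. }
  assert (F : forall i, (i < 9)%nat -> grown a (Fd Root i)).
  { induction i as [|i IH]; intros Hi; [now constructor|].
    apply step with (Fd Root i); [apply IH; lia|constructor; cbn; lia|cbn; lia|easy|easy]. }
  induction j as [|j IH]; intros Hj.
  - apply step with (Fd Root 8); [apply F; lia|now constructor|cbn; lia|easy|easy].
  - apply step with (Co Root j); [apply IH; lia|now constructor|cbn; lia|easy|easy].
Qed.

(** The two possible turns start in the same cell, which cannot stay empty; its occupant decides the
    world. *)
Lemma turn_grows a :
  stuck a -> all_grown a -> at_node a (Fd Root 0) -> exists D, grown a (Tp Root D 0).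
Proof.
  intros T A S0. pose proof h_ge6.
  assert (G : grown a (Co Root (h - 1))) by (apply first_column_grows; auto; lia).
  assert (N : a (node_pos (Tp Root L 0)) <> None).
  { apply (child_occupied a (Co Root (h - 1))); auto; [constructor; lia|cbn; lia]. }
  destruct (a (node_pos (Tp Root L 0))) as [t|] eqn:E; [|easy].
  destruct (A _ _ E) as (u & Gu & P). exists (world u).
  rewrite <- (overlap (world u) u (Tp Root (world u) 0)); auto.
  - exact (grown_in_range _ _ Gu).
  - cbn; lia.
  - apply in_own_world.
  - easy.
  - easy.
  - rewrite P. cbn. f_equal; lia.
Qed.

Lemma trunk_complete a :
  stuck a -> all_grown a -> at_node a (Fd Root 0) ->
  exists D, grown a (Ex D 3) /\ grown a (Co (Step D (c - 1)) (h - 1)).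
Proof.
  intros T A S0. pose proof h_ge6 as Hh. destruct (turn_grows a T A S0) as [D GT].
  exists D. pose proof (exit_length_ge D) as HL.
  assert (step : forall u w, grown a u -> child u w -> in_range w -> on_trunk w ->
                 in_world D w -> grown a w).
  { intros u w G C V K W. apply trunk_grows with u; auto.
    intros u' G'. exists D. split; [|easy].
    apply (grown_in_world a); [exact (grown_at _ _ GT)|easy]. }
  assert (G1 : grown a (Tp Root D 2)).
  { apply step with (Tp Root D 1); [|now constructor; lia|cbn; lia|easy|easy].
    apply step with (Tp Root D 0); [easy|now constructor; lia|cbn; lia|easy|easy]. }
  assert (G2 : forall k, (k < h)%nat -> grown a (Re Root D (h - 1 - k))).
  (* The returning column grows downwards, hence the index [h - 1 - k]. *)
  { induction k as [|k IH]; intros Hk.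
    - apply step with (Tp Root D 2); [easy|constructor; lia|cbn; lia|easy|easy].
    - apply step with (Re Root D (S (h - 1 - S k))); [|constructor|cbn; lia|easy|easy].
      replace (S (h - 1 - S k)) with (h - 1 - k)%nat by lia. apply IH; lia. }
  assert (G3 : forall k, (k < exit_length D)%nat -> grown a (Ex D k)).
  { induction k as [|k IH]; intros Hk.
    - apply step with (Re Root D 0); [|constructor|cbn; lia|easy|easy].
      replace 0%nat with (h - 1 - (h - 1))%nat by lia. apply G2; lia.
    - apply step with (Ex D k); [apply IH; lia|now constructor|easy|easy|easy]. }
  assert (G4 : forall i, (i < c)%nat -> forall k, in_range (St D i k) -> grown a (St D i k)).
  { induction i as [|i IHi]; intros Hi; induction k as [|k IHk]; intros (_ & Hk & Hc).
    - apply step with (Ex D (exit_length D - 1)); [apply G3; lia|constructor; lia|cbn; lia|easy|easy].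
    - apply step with (St D 0 k); [apply IHk; cbn; lia|constructor; lia|cbn; lia|easy|easy].
    - apply step with (St D i (v + 7)); [apply IHi; cbn; lia|constructor; lia|cbn; lia|easy|easy].
    - apply step with (St D (S i) k); [apply IHk; cbn; lia|constructor; lia|cbn; lia|easy|easy]. }
  assert (G5 : forall k, (k < 12)%nat -> grown a (Fd (Step D (c - 1)) k)).
  { induction k as [|k IH]; intros Hk.
    - apply step with (St D (c - 1) (v - 1));
        [apply G4; cbn; lia|constructor; lia|cbn; lia|cbn; lia|easy].
    - apply step with (Fd (Step D (c - 1)) k);
        [apply IH; lia|constructor; cbn; lia|cbn; lia|cbn; lia|easy]. }
  assert (G6 : forall k, (k < h)%nat -> grown a (Co (Step D (c - 1)) k)).
  { induction k as [|k IH]; intros Hk.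
    - apply step with (Fd (Step D (c - 1)) 11);
        [apply G5; lia|now constructor|cbn; lia|cbn; lia|easy].
    - apply step with (Co (Step D (c - 1)) k);
        [apply IH; lia|now constructor|cbn; lia|cbn; lia|easy]. }
  split; [apply G3; lia|apply G6; lia].
Qed.

Lemma terminal_height a :
  terminal system a -> finite_assembly a /\ has_height a (c * v + h + 2).
Proof.
  intros [P T]. pose proof (producible_grown a P) as A. pose proof h_ge6 as Hh.
  assert (B : forall q, a q <> None ->
    - (8 * Z.of_nat c + 20) <= fst q <= 20 /\ -3 <= snd q <= top).
  { intros q H. destruct (a q) as [t|] eqn:E; [|easy].
    destruct (A q t E) as (u & G & <-). now apply (grown_bounds a). }
  split; [exact (box_finite _ _ _ _ _ B)|].
  destruct (trunk_complete a T A (producible_seed a P)) as (D & G & G').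
  (* Lowest row: the bend of the free exit. Highest row: the turn of the last column, where only the
     occupancy of the cell matters, so [L] serves whichever way it turned. *)
  exists (node_pos (Ex D 3)), (node_pos (Tp (Step D (c - 1)) L 0)).
  assert (Y : snd (node_pos (Tp (Step D (c - 1)) L 0)) = top).
  { cbn [node_pos base fst snd]. unfold step_y, top.
    replace (Z.of_nat (c - 1)) with (Z.of_nat c - 1) by lia. lia. }
  rewrite Y. change (snd (node_pos (Ex D 3))) with (-3).
  split; [|split; [|split]].
  - rewrite (grown_at _ _ G). discriminate.
  - apply (child_occupied a (Co (Step D (c - 1)) (h - 1))); auto; [constructor; lia|cbn; lia].
  - intros q H'. now apply B.
  - unfold top. lia.
Qed.

End Construction.

(** * Small sizes, the choice of parameters and the asymptotics *)

(* For small n the asymptotics allow any fixed height. *)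
Definition glueless_tile (j : nat) : tile := mkTile (S j) 0 0 0.

Definition glueless (n : nat) : tas :=
  mkTAS (map glueless_tile (seq 0 n)) (0, 0)%Z (glueless_tile 0).

(** The north glues tell the types apart, and nothing binds because all other sides are null. *)
Lemma glueless_spec n : (1 <= n)%nat ->
  well_formed_with_size (glueless n) n /\
  forall a, terminal (glueless n) a -> finite_assembly a /\ has_height a 1.
Proof.
  intros Hn. split; [repeat split; cbn|].
  - apply Injective_map_NoDup; [now intros x y [= ->]|apply seq_NoDup].
  - now rewrite length_map, length_seq.
  - apply in_map, in_seq; lia.
  - intros a [(f & P & _ & A) _].
    assert (F : forall b, fin_producible (glueless n) b ->
      forall q, b q = seed (glueless n) q).
    { induction 1 as [b E|b b' _ IH (p & u & U & At & E)]; [easy|exfalso].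
      apply in_map_iff in U as (j & <- & _).
      apply attachable_spec in At as (_ & q & d & w & W & _ & B & Z).
      rewrite IH in W. unfold seed in W. destruct (_ && _); [|easy].
      injection W as <-. now destruct d. }
    assert (S1 : forall q, a q <> None -> q = (0, 0)%Z).
    { intros [x y] H. destruct (a (x, y)) as [u|] eqn:E; [|easy].
      apply A in E as [i E]. rewrite (F _ (P i)) in E. unfold seed in E. cbn in E.
      destruct (Z.eqb_spec x 0); [|easy]. destruct (Z.eqb_spec y 0); [|easy]. now subst. }
    assert (S2 : a (0, 0)%Z <> None).
    { assert (E : a (0, 0)%Z = Some (glueless_tile 0)) by (apply A; exists 0%nat; now rewrite (F _ (P 0%nat))).
      rewrite E. discriminate. }
    split.
    + exists [(0, 0)%Z]. intros q H. left. now rewrite (S1 q H).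
    + exists (0, 0)%Z, (0, 0)%Z. repeat split; auto; apply S1 in H; subst; cbn; lia.
Qed.

(* With c = v = k = sqrt n - 10 the system has h + 17 k + 28 types and height
   k^2 + h + 2; the staircase needs k^2 <= h + 2. *)
Definition steps (n : nat) : nat := (Nat.sqrt n - 10)%nat.

(** This is [c * v + h + 2] for [h = n - 17 * steps n - 28]. From 196 = 14 * 14 on, [steps n] is at
    least 4. *)
Definition height (n : nat) : nat :=
  (if n <? 196 then 1 else steps n * steps n + n - 17 * steps n - 26)%nat.

Lemma height_asymptotics : two_n_plus_little_o height.
Proof.
  intros k Hk. exists ((39 * k + 14) * (39 * k + 14))%nat. intros n Hn.
  unfold height, steps. pose proof (Nat.sqrt_spec n ltac:(lia)) as [S1 S2].
  set (s := Nat.sqrt n) in *.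
  assert (Hs : (39 * k + 14 <= s)%nat) by nia.
  destruct (Nat.ltb_spec n 196); [nia|].
  (* With [s * s - n] between [- 2 * s] and 0, the difference is [s * s - n - 37 * s + 244]; its
     absolute value times [k] is at most [s * s], since [s >= 39 * k]. *)
  assert (Z.abs (Z.of_nat ((s - 10) * (s - 10) + n - 17 * (s - 10) - 26) - 2 * Z.of_nat n)
          <= 39 * Z.of_nat s) by nia.
  nia.
Qed.

Theorem mainTheorem2 :
  exists (Tn : nat -> tas) (h : nat -> nat),
    two_n_plus_little_o h /\
    forall n : nat, (1 <= n)%nat ->
      well_formed_with_size (Tn n) n /\
      forall a : assembly, terminal (Tn n) a ->
        finite_assembly a /\ has_height a (h n).
Proof.
  exists (fun n => if (n <? 196)%nat then glueless n
                   else system (n - 17 * steps n - 28) (steps n) (steps n)), height.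
  split; [exact height_asymptotics|]. intros n Hn. unfold height.
  destruct (Nat.ltb_spec n 196) as [Hs|Hs]; [now apply glueless_spec|].
  pose proof (Nat.sqrt_spec n ltac:(lia)) as [S1 S2].
  assert (K : (4 <= steps n)%nat) by (unfold steps; nia).
  (* This is [(steps n + 10)] squared; it makes the subtractions exact and yields [wall_high]. *)
  assert (Q : (steps n * steps n + 20 * steps n + 100 <= n)%nat) by (unfold steps in *; nia).
  split.
  - assert (E : (n - 17 * steps n - 28 + steps n + 16 * steps n + 28)%nat = n) by lia.
    pose proof (system_well_formed (n - 17 * steps n - 28) (steps n) (steps n)) as W.
    rewrite E in W. apply W; lia.
  - intros a H. apply terminal_height in H; [|lia..].
    now replace (steps n * steps n + n - 17 * steps n - 26)%nat
      with (steps n * steps n + (n - 17 * steps n - 28) + 2)%nat by lia.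
Qed.
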